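(* For each positive integer $n$, the partial Brauer semigroup $P\mathfrak{B}_n$ and the Brauer semigroup $\mathfrak{B}_n$ satisfy $c(P\mathfrak{B}_n)=c(\mathfrak{B}_n)=\lfloor\frac{n}{2}\rfloor$, where $c$ denotes Krohn--Rhodes complexity.
   Context: All semigroups are finite. Krohn--Rhodes complexity: a semigroup $S$ divides $T$ if $S$ is a homomorphic image of a subsemigroup of $T$. The (group or Krohn--Rhodes) complexity $c(S)$ is the least integer $m\ge 0$ such that $S$ divides an iterated wreath product $A_m\wr G_m\wr A_{m-1}\wr\cdots\wr A_1\wr G_1\wr A_0$, where the $G_i$ are finite groups and the $A_i$ are finite aperiodic semigroups (all of whose subgroups are trivial). (Here one may take $S\wr T=S^{T^I}\rtimes T$, where $T^I$ is $T$ with a new identity adjoined, with $(f,t)(g,u)=(h,tu)$, $h(x)=f(x)g(xt)$, and bracket iterated products to the right.) (Partial) Brauer semigroup: let $[n]=\{1,\dots,n\}$, $[n]'=\{1',\dots,n'\}$, $[n]''=\{1'',\dots,n''\}$ be disjoint copies. The partition semigroup $\mathfrak{C}_n$ consists of all partitions (equivalently, equivalence relations) of $[n]\cup[n]'$. The product $\xi\eta$ is computed as follows: let $\eta'$ be the equivalence relation on $[n]'\cup[n]''$ obtained from $\eta$ by replacing each $k$ by $k'$ and each $k'$ by $k''$; take the equivalence relation on $[n]\cup[n]'\cup[n]''$ generated by $\xi\cup\eta'$; restrict it to $[n]\cup[n]''$; finally replace each $k''$ by $k'$. This makes $\mathfrak{C}_n$ a monoid. $\mathfrak{B}_n$ (respectively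 $P\mathfrak{B}_n$) is the subsemigroup of $\mathfrak{C}_n$ consisting of all elements all of whose blocks have size exactly $2$ (respectively size at most $2$). *)

(* Defs.v *)
From HB Require Import structures.
From mathcomp Require Import all_boot.

Set Implicit Arguments.
Unset Strict Implicit.
Unset Printing Implicit Defensive.

Local Open Scope group_scope.

(* Hierarchy-Builder refuses this structure once fingroup has been loaded,     *)
(* because finStarMonoidType lies below it: hence the Require of fingroup only *)
(* afterwards, and the explicit instance on finGroupType.                      *)
#[short(type="finSemigroupType")]
HB.structure Definition FinSemigroup := {S of Semigroup S & Finite S}.

From mathcomp Require Import all_fingroup.

Definition finGroup_finSemigroup (G : finGroupType) : finSemigroupType :=
  HB.pack (FinGroup.sort G) (FinGroup.on G).
HB.instance Definition _ (G : finGroupType) :=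
  FinSemigroup.copy (FinGroup.sort G) (finGroup_finSemigroup G).

Definition is_subgroup (S : finSemigroupType) (H : {set S}) : Prop :=
  {in H &, forall x y, x * y \in H} /\
  exists2 e, e \in H &
    {in H, forall x, [/\ e * x = x, x * e = x &
                         exists2 y, y \in H & x * y = e /\ y * x = e]}.

Definition aperiodic (S : finSemigroupType) : Prop :=
  forall H : {set S}, is_subgroup H -> #|H| = 1%N.

(* The values of f outside U are irrelevant. *)
Definition divides (S T : finSemigroupType) : Prop :=
  exists (U : {set T}) (f : T -> S),
    [/\ {in U &, forall x y, x * y \in U},
        {in U &, {morph f : x y / x * y}} &
        f @: U = [set: S]].

(* T^I is option T, with I = None; only its right action by T is needed. *)
Definition mul_adjoin (T : finSemigroupType) (x : option T) (t : T) : option T :=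
  Some (if x is Some y then y * t else t).

Definition wreath (S T : finSemigroupType) : Type :=
  ({ffun option T -> S} * T)%type.

Section Wreath.
Variables S T : finSemigroupType.

HB.instance Definition _ := Finite.on (wreath S T).

Definition wreath_mul (p q : wreath S T) : wreath S T :=
  ([ffun x => p.1 x * q.1 (mul_adjoin x p.2)], p.2 * q.2).

Lemma wreath_mulA : associative wreath_mul.
Proof.
move=> [f t] [g u] [h v]; congr (_, _) => /=; last exact: mulgA.
apply/ffunP=> x; rewrite !ffunE /= mulgA; congr (_ * h _).
by case: x => [y|] //=; rewrite /mul_adjoin mulgA.
Qed.

HB.instance Definition _ := isSemigroup.Build (wreath S T) wreath_mulA.

End Wreath.

(* A_m wr (G_m wr (A_{m-1} wr ( ... wr (G_1 wr A_0)))); G 0 is unused. *)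
Fixpoint iter_wreath (A : nat -> finSemigroupType) (G : nat -> finGroupType)
    (m : nat) : finSemigroupType :=
  if m is k.+1 then wreath (A k.+1) (wreath (G k.+1) (iter_wreath A G k))
  else A 0%N.

Definition decomposable (S : finSemigroupType) (m : nat) : Prop :=
  exists (A : nat -> finSemigroupType) (G : nat -> finGroupType),
    (forall i, (i <= m)%N -> aperiodic (A i)) /\ divides S (iter_wreath A G m).

(* c(S) = m, the complexity being the minimum of the m with decomposable S m. *)
Definition has_complexity (S : finSemigroupType) (m : nat) : Prop :=
  decomposable S m /\ forall k, decomposable S k -> (m <= k)%N.

Lemma has_complexity_uniq S m k :
  has_complexity S m -> has_complexity S k -> m = k.
Proof.
move=> [Sm minm] [Sk mink].
by apply/eqP; rewrite eqn_leq (minm _ Sk) (mink _ Sm).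
Qed.

(* inl k stands for k in [n], and inr k for k' in [n]'. *)
Definition points (n : nat) := ('I_n + 'I_n)%type.

(* Similarly [n], [n]' and [n]'' are the three summands, from left to right. *)
Definition points3 (n : nat) := ('I_n + 'I_n + 'I_n)%type.

Record partition_semigroup (n : nat) := PartitionSemigroup {
  blocks : {set {set points n}};
  blocksP : partition blocks [set: points n]
}.

HB.instance Definition _ n := [isSub for @blocks n].
HB.instance Definition _ n := [Finite of partition_semigroup n by <:].

Definition same_block (n : nat) (P : partition_semigroup n) : rel (points n) :=
  fun x y => y \in pblock (blocks P) x.

Definition push_rel (T U : finType) (f : T -> U) (r : rel T) : rel U :=
  fun u v => [exists x, exists y, [&& u == f x, v == f y & r x y]].

Definition upper n (x : points n) : points3 n := inl x.

Definition lower n (x : points n) : points3 n :=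
  match x with inl i => inl (inr i) | inr i => inr i end.

Definition outer n (x : points n) : points3 n :=
  match x with inl i => inl (inl i) | inr i => inr i end.

(* This relation is symmetric, so connect is the equivalence it generates. *)
Definition stack n (P Q : partition_semigroup n) : rel (points3 n) :=
  relU (push_rel (@upper n) (same_block P))
       (push_rel (@lower n) (same_block Q)).

Definition partition_mul_rel n (P Q : partition_semigroup n) : rel (points n) :=
  fun x y => connect (stack P Q) (outer x) (outer y).

Section PushRel.
Variables (T U : finType) (f : T -> U).

Lemma push_relP (r : rel T) u v :
  reflect (exists x y, [/\ u = f x, v = f y & r x y]) (push_rel f r u v).
Proof.
apply: (iffP existsP) => [[x /existsP[y /and3P[/eqP-> /eqP-> rxy]]]|].
  by exists x, y.
by case=> x [y [-> -> rxy]]; exists x; apply/existsP; exists y; rewrite !eqxx.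
Qed.

Lemma push_rel_sym (r : rel T) : symmetric r -> symmetric (push_rel f r).
Proof.
move=> rC u v; apply/push_relP/push_relP=> -[x [y [-> -> rxy]]].
  by exists y, x; rewrite rC.
by exists y, x; rewrite rC.
Qed.

Lemma push_relU (r s : rel T) :
  push_rel f (relU r s) =2 relU (push_rel f r) (push_rel f s).
Proof.
move=> u v; apply/push_relP/orP.
  move=> [x [y [-> -> /orP[rxy|sxy]]]]; [left|right]; apply/push_relP;
  by exists x, y.
case=> /push_relP[x [y [-> -> rxy]]]; exists x, y; split=> //; rewrite /= rxy //.
exact: orbT.
Qed.

Lemma eq_push_rel (r s : rel T) : r =2 s -> push_rel f r =2 push_rel f s.
Proof.
move=> e u v; apply/push_relP/push_relP=> -[x [y [-> -> rxy]]]; exists x, y.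
  by rewrite -e.
by rewrite e.
Qed.

Lemma connect_push_ex (r : rel T) x v : injective f ->
  connect (push_rel f r) (f x) v -> exists2 y, v = f y & connect r x y.
Proof.
move=> fI /connectP[p pP ->]; elim: p x pP => [|w p IH] x /=; first by exists x.
case/andP=> /push_relP[x1 [y1 [/fI <- -> rxy]]] /IH[y -> cy]; exists y => //.
exact: connect_trans (connect1 rxy) cy.
Qed.

Lemma connect_push (r : rel T) x y : injective f ->
  connect (push_rel f r) (f x) (f y) = connect r x y.
Proof.
move=> fI; apply/idP/idP=> [/(connect_push_ex fI)[z /fI ->] //|].
case/connectP=> p pP ->; elim: p x pP => [|w p IH] x //= /andP[rxw /IH].
by apply/connect_trans/connect1/push_relP; exists x, w.
Qed.

End PushRel.

Lemma push_push (T U V : finType) (f : T -> U) (g : U -> V) r :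
  push_rel g (push_rel f r) =2 push_rel (g \o f) r.
Proof.
move=> u v; apply/push_relP/push_relP.
  by move=> [x [y [-> -> /push_relP[z [t [-> -> rzt]]]]]]; exists z, t.
move=> [x [y [-> -> rxy]]]; exists (f x), (f y); split=> //.
by apply/push_relP; exists x, y.
Qed.

Lemma eq_relU (T : Type) (r r' s s' : rel T) :
  r =2 r' -> s =2 s' -> relU r s =2 relU r' s'.
Proof. by move=> er es x y; rewrite /= er es. Qed.

Lemma relUC (T : Type) (r s : rel T) : relU r s =2 relU s r.
Proof. by move=> x y; rewrite /= orbC. Qed.

Lemma relUA (T : Type) (r s t : rel T) :
  relU r (relU s t) =2 relU (relU r s) t.
Proof. by move=> x y; rewrite /= orbA. Qed.

(* Contracting the e1-steps between two points of D. *)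
Lemma connect_contract (V : finType) (D : pred V) (e1 e2 r : rel V) :
    (forall u v, e2 u v -> D u && D v) ->
    (forall u v, r u v -> connect e1 u v) ->
    (forall u v, D u -> D v -> connect e1 u v -> connect (relU r e2) u v) ->
  forall x y, D x -> D y ->
    connect (relU e1 e2) x y = connect (relU r e2) x y.
Proof.
move=> e2D re1 e1r x y Dx Dy; apply/idP/idP.
  case/connectP=> p pP ey.
  suff [u Du [cxu cuy]] :
      exists2 u, D u & connect (relU r e2) x u /\ connect e1 u y.
    exact: connect_trans cxu (e1r _ _ Du Dy cuy).
  clear Dy; elim/last_ind: p y pP ey => [|p z IH] y /=.
    by move=> _ ->; exists x.
  rewrite rcons_path last_rcons => /andP[/IH IHp stp ->].
  have [u Du [cxu cul]] := IHp _ erefl.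
  case/orP: stp => [stp|stp].
    by exists u => //; split=> //; apply: connect_trans cul (connect1 stp).
  have /andP[Dl Dz] := e2D _ _ stp; exists z => //; split=> //.
  apply: connect_trans cxu (connect_trans (e1r _ _ Du Dl cul) (connect1 _)).
  by rewrite /= stp orbT.
apply: connect_sub => u v /= /orP[/re1|e2uv].
  by apply: connect_sub => a b ab; apply: connect1; rewrite /= ab.
by apply: connect1; rewrite /= e2uv orbT.
Qed.

Section PartitionMul.
Variable n : nat.
Implicit Types P Q R : partition_semigroup n.

Lemma same_block_equiv P : equivalence_rel (same_block P).
Proof.
by move=> x y z; apply: (pblock_equivalence (blocksP P)); rewrite inE.
Qed.

Lemma same_block_refl P : reflexive (same_block P).
Proof. by case/equivalence_relP: (same_block_equiv P). Qed.

Lemma same_block_sym P : symmetric (same_block P).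
Proof.
case/equivalence_relP: (same_block_equiv P) => rP lP x y.
by apply/idP/idP=> /lP <-; apply: rP.
Qed.

Lemma same_block_trans P : transitive (same_block P).
Proof.
case/equivalence_relP: (same_block_equiv P) => rP lP y x z xy yz.
by rewrite (lP _ _ xy).
Qed.

Lemma same_block_inj P Q : same_block P =2 same_block Q -> P = Q.
Proof.
move=> ePQ; apply: val_inj => /=.
rewrite -(equivalence_partition_pblock (blocksP P)).
rewrite -(equivalence_partition_pblock (blocksP Q)).
apply: eq_imset => x; apply/setP=> y; rewrite !inE /=.
exact: ePQ.
Qed.

Lemma stack_sym P Q : symmetric (stack P Q).
Proof.
move=> u v; rewrite /stack /=.
by congr (_ || _); apply: push_rel_sym; apply: same_block_sym.
Qed.

Lemma partition_mul_equiv P Q : equivalence_rel (partition_mul_rel P Q).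
Proof.
have cC := sym_connect_sym (stack_sym P Q).
apply/equivalence_relP; split=> [x|x y xy z]; first exact: connect0.
exact: same_connect.
Qed.

Lemma partition_mul_subproof P Q :
  partition (equivalence_partition (partition_mul_rel P Q) [set: points n])
            [set: points n].
Proof.
by apply: equivalence_partitionP => x y z _ _ _; apply: partition_mul_equiv.
Qed.

Definition partition_mul P Q : partition_semigroup n :=
  PartitionSemigroup (partition_mul_subproof P Q).

Lemma same_block_mul P Q :
  same_block (partition_mul P Q) =2 partition_mul_rel P Q.
Proof.
move=> x y; apply: pblock_equivalence_partition; rewrite ?inE // => a b c _ _ _.
exact: partition_mul_equiv.
Qed.

(* j and k embed three layers into four, j carrying the product P * Q and k   *)
(* the product of P * Q (placed by c) with R (placed by d).                   *)
Lemma mul_in_four_layers (V : finType) (j k : points3 n -> V)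
    (c d : points n -> points3 n) P Q R :
    injective j -> injective k ->
    (forall x, k (c x) = j (outer x)) ->
    (forall p, (exists x, p = c x) \/ (forall q, k p <> j q)) ->
  forall p q,
    connect (relU (push_rel c (same_block (partition_mul P Q)))
                  (push_rel d (same_block R))) p q =
    connect (relU (relU (push_rel (j \o @upper n) (same_block P))
                        (push_rel (j \o @lower n) (same_block Q)))
                  (push_rel (k \o d) (same_block R))) (k p) (k q).
Proof.
move=> jI kI kc kD p q.
set e1 := relU (push_rel (j \o _) _) _; set e2 := push_rel (k \o d) _.
have e1E : push_rel j (stack P Q) =2 e1.
  by move=> u v; rewrite push_relU /e1 /= !push_push.
rewrite -(connect_push _ _ _ kI) (eq_connect (push_relU _ _ _)).
rewrite (eq_connect (eq_relU (push_push _ _ _) (push_push _ _ _))).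
symmetry; apply: (connect_contract (D := [pred v in codom k])) => /=;
  rewrite ?codom_f //.
- by move=> u v /push_relP[x [y [-> -> _]]]; rewrite /= !codom_f.
- move=> u v /push_relP[x [y [-> -> ]]]; rewrite /= !kc same_block_mul.
  by rewrite -(eq_connect e1E) connect_push.
move=> u v /codomP[p1 ->] /codomP[q1 ->]; rewrite -(eq_connect e1E) => c1.
have [[x ex]|p1D] := kD p1; last first.
  case/connectP: c1 => -[|w s] /=; first by move=> _ ->.
  by case/andP=> /push_relP[z [t [/p1D]]].
have [[y ey]|q1D] := kD q1; last first.
  move: c1; rewrite sym_connect_sym; last exact: (push_rel_sym _ (stack_sym P Q)).
  case/connectP=> -[|w s] /=; first by move=> _ ->.
  by case/andP=> /push_relP[z [t [/q1D]]].
subst p1 q1; apply: connect1; apply/orP; left; apply/push_relP.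
exists x, y; split=> //; rewrite same_block_mul.
by move: c1; rewrite !kc connect_push.
Qed.

Let V4 := (points3 n + 'I_n)%type.
Let i123 (p : points3 n) : V4 := inl p.
Let i234 (p : points3 n) : V4 :=
  match p with
  | inl (inl i) => inl (inl (inr i)) | inl (inr i) => inl (inr i)
  | inr i => inr i end.
Let i134 (p : points3 n) : V4 :=
  match p with
  | inl (inl i) => inl (inl (inl i)) | inl (inr i) => inl (inr i)
  | inr i => inr i end.
Let i124 (p : points3 n) : V4 :=
  match p with
  | inl (inl i) => inl (inl (inl i)) | inl (inr i) => inl (inl (inr i))
  | inr i => inr i end.

Lemma partition_mulA : associative partition_mul.
Proof.
move=> P Q R; apply: same_block_inj => x y; rewrite !same_block_mul.
rewrite /partition_mul_rel /stack.
rewrite (eq_connect (relUC _ _)).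
rewrite (@mul_in_four_layers _ i234 i124); first last.
- case=> [[i|i]|i]; [right=> -[[?|?]|?] //|left; by exists (inl i)|
    left; by exists (inr i)].
- by case.
- by move=> [[i|i]|i] [[k|k]|k] //= [->].
- by move=> [[i|i]|i] [[k|k]|k] //= [->].
rewrite (@mul_in_four_layers _ i123 i134); first last.
- case=> [[i|i]|i]; [left; by exists (inl i)|left; by exists (inr i)|
    right=> -[[?|?]|?] //].
- by case.
- by move=> [[i|i]|i] [[k|k]|k] //= [->].
- by move=> ? ? [].
have k4 (z : points n) : i124 (outer z) = i134 (outer z) by case: z.
rewrite !k4; apply: eq_connect => u v; rewrite /= orbC orbA.
have pe (f g : points n -> V4) S : f =1 g ->
    push_rel f (same_block S) u v = push_rel g (same_block S) u v.
  move=> fg; apply/push_relP/push_relP=> -[a [b [-> -> ab]]]; exists a, b.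
    by rewrite !fg.
  by rewrite -!fg.
by congr (_ || _ || _); apply: pe; case.
Qed.

HB.instance Definition _ :=
  isSemigroup.Build (partition_semigroup n) partition_mulA.

End PartitionMul.

Lemma even_card_involution (T : finType) (A : {set T}) (f : T -> T) :
    involutive f -> {in A, forall x, f x \in A} -> {in A, forall x, f x != x} ->
  ~~ odd #|A|.
Proof.
move=> fK; have [m] := ubnP #|A|; elim: m A => // m IH A ltAm fA fN.
have [->|[x Ax]] := set_0Vmem A; first by rewrite cards0.
have Afx : f x \in A :\ x by rewrite !inE fN ?fA.
rewrite (cardsD1 x) Ax (cardsD1 (f x)) Afx /= negbK; apply: IH.
- by rewrite (cardsD1 x) Ax (cardsD1 (f x)) Afx !add1n ltnS in ltAm; apply: ltnW.
- move=> y; rewrite !inE => /and3P[yfx yx Ay]; rewrite fA // andbT.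
  by rewrite (can_eq fK) yx /= (can2_eq fK fK).
by move=> y; rewrite !inE => /and3P[_ _ /fN].
Qed.

(* A connected component of two superposed partial matchings contains at most *)
(* two vertices missed by one of them.                                        *)
Section TwoInvolutions.
Variable V : finType.

Definition step2 (a b : V -> V) : rel V := fun u v => (v == a u) || (v == b u).

Definition end2 (a b : V -> V) (u : V) := (a u == u) || (b u == u).

Section Walk.
Variables (a b : V -> V) (x : V).
Hypotheses (aK : involutive a) (bK : involutive b) (bx : b x = x).

Fixpoint walk (k : nat) : V :=
  if k is k'.+1 then (if odd k' then b else a) (walk k') else x.

Lemma walk_next k : (if odd k then b else a) (walk k) = walk k.+1.
Proof. by []. Qed.

Lemma walk_prev k : (if odd k then a else b) (walk k) = walk k.-1.
Proof. by case: k => [|k] //=; case: (odd k) => /=; rewrite ?aK ?bK. Qed.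

Lemma walk_ab k :
  (a (walk k) = walk k.+1 /\ b (walk k) = walk k.-1) \/
  (a (walk k) = walk k.-1 /\ b (walk k) = walk k.+1).
Proof.
have := walk_next k; have := walk_prev k.
by case: (odd k) => h1 h2; [right|left].
Qed.

Lemma connect_walk y : connect (step2 a b) x y -> exists k, y = walk k.
Proof.
case/connectP=> p; elim/last_ind: p y => [|p z IH] y; first by exists 0%N.
rewrite rcons_path last_rcons => /andP[/IH /(_ erefl)[k ek] st ->].
rewrite ek /step2 in st.
by case/orP: st => /eqP->; case: (walk_ab k) => -[ea eb]; rewrite ?ea ?eb;
  [exists k.+1|exists k.-1|exists k.-1|exists k.+1].
Qed.

Lemma walk_end k : end2 a b (walk k) -> walk k != x ->
  exists2 m, (k = m \/ k = m.+1) & walk m.+1 = walk m.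
Proof.
move=> ek nx.
have [e|e] : walk k.+1 = walk k \/ walk k.-1 = walk k.
- by case: (walk_ab k) ek; rewrite /end2 => -[-> ->] /orP[] /eqP;
    [left|right|right|left].
- by exists k; [left|].
exists k.-1; last by case: k e {ek} nx => //=; rewrite eqxx.
by right; case: k nx {ek e} => //=; rewrite eqxx.
Qed.

Lemma end2_uniq_walk y z :
    connect (step2 a b) x y -> connect (step2 a b) x z ->
    y != x -> z != x -> end2 a b y -> end2 a b z -> y = z.
Proof.
move=> cy cz nyx nzx ey ez.
have exs : exists m, walk m.+1 == walk m.
  have [k ek] := connect_walk cy.
  by rewrite ek in ey nyx; have [m _ em] := walk_end ey nyx; exists m; apply/eqP.
case: (ex_minnP exs) => i /eqP ei mini {exs}.
have short v : connect (step2 a b) x v -> exists2 k, (k <= i)%N & v = walk k.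
  case/connectP=> p; elim/last_ind: p v => [|p w IH] v; first by exists 0%N.
  rewrite rcons_path last_rcons => /andP[/IH /(_ erefl)[k ki ek] st ->].
  rewrite ek /step2 in st.
  have [->|->] : w = walk k.+1 \/ w = walk k.-1.
  - by case/orP: st => /eqP->; case: (walk_ab k) => -[ea eb]; rewrite ?ea ?eb; auto.
  - move: ki; rewrite leq_eqVlt => /orP[/eqP->|ki]; last by exists k.+1.
    by exists i.
  by exists k.-1 => //; apply: leq_trans ki; apply: leq_pred.
suff last v : connect (step2 a b) x v -> v != x -> end2 a b v -> v = walk i.
  by rewrite (last y) // (last z).
case/short=> k ki -> nvx /walk_end /(_ nvx)[m km /eqP em].
have {em mini} im := mini _ em; congr walk.
case: km => km; apply/eqP; rewrite eqn_leq ki km //.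
by move: (leq_trans im (leqnSn m)); rewrite -km.
Qed.

End Walk.

Lemma end2_uniq a b x y z : involutive a -> involutive b -> end2 a b x ->
    connect (step2 a b) x y -> connect (step2 a b) x z ->
    y != x -> z != x -> end2 a b y -> end2 a b z -> y = z.
Proof.
move=> aK bK /orP[]/eqP hx; last exact: end2_uniq_walk.
have sC : step2 a b =2 step2 b a by move=> u v; apply: orbC.
rewrite !(eq_connect sC) => cy cz nyx nzx; rewrite /end2 ![(a _ == _) || _]orbC.
exact: (end2_uniq_walk bK aK hx).
Qed.

End TwoInvolutions.

Section Brauer.
Variable n : nat.
Implicit Types P Q : partition_semigroup n.

Lemma forall_blocks P (p : pred nat) :
  [forall B in blocks P, p #|B|] = [forall x, p #|pblock (blocks P) x|].
Proof.
have /and3P[/eqP covP tiP n0P] := blocksP P.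
apply/forall_inP/forallP => [h x|h B PB].
  by apply: h; rewrite pblock_mem // covP inE.
have [B0|[x Bx]] := set_0Vmem B; first by rewrite B0 in PB; rewrite PB in n0P.
by rewrite -(def_pblock tiP PB Bx).
Qed.

Definition is_partial_brauer P := [forall B in blocks P, #|B| <= 2]%N.

Definition is_brauer P := [forall B in blocks P, #|B| == 2].

Lemma brauer_partial P : is_brauer P -> is_partial_brauer P.
Proof.
by move=> /forall_inP h; apply/forall_inP => B /h /eqP->.
Qed.

Definition mate P (x : points n) : points n :=
  odflt x [pick y | same_block P x y & y != x].

Lemma same_blockE P x y : is_partial_brauer P ->
  same_block P x y = (y == x) || (y == mate P x).
Proof.
rewrite /is_partial_brauer (forall_blocks _ (fun k => k <= 2)%N).
move=> /forallP/(_ x) le2.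
rewrite /mate; case: pickP => [z /andP[xz zx]|no] /=; last first.
  rewrite orbb; apply/idP/eqP => [xy|->]; last exact: same_block_refl.
  by apply/eqP; move: (no y); rewrite xy => /negbFE.
apply/idP/orP => [xy|[]/eqP-> //]; last exact: same_block_refl.
have xP : x \in pblock (blocks P) x by apply: same_block_refl.
rewrite (cardsD1 x) xP /= add1n ltnS in le2.
have [yx|yx] := eqVneq y x; [by left|right; apply/eqP].
by apply: (card_le1_eqP le2); rewrite !inE ?yx ?zx.
Qed.

Lemma mate_block P x : same_block P x (mate P x).
Proof.
by rewrite /mate; case: pickP => [z /andP[]|_] //=; apply: same_block_refl.
Qed.

Lemma mateK P : is_partial_brauer P -> involutive (mate P).
Proof.
move=> pbP x; have := mate_block P x; rewrite same_block_sym same_blockE //.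
have [e|ne] := eqVneq x (mate P x); first by rewrite -!e.
by move=> /eqP.
Qed.

Lemma mate_neq P x : is_brauer P -> mate P x != x.
Proof.
rewrite /is_brauer (forall_blocks _ (fun k => k == 2)).
move=> /forallP/(_ x)/eqP eq2; rewrite /mate; case: pickP => [y /andP[]|no] //=.
suff : (#|pblock (blocks P) x| <= #|[set x]|)%N by rewrite eq2 cards1.
apply/subset_leq_card/subsetP=> y xy; rewrite inE.
by apply: contraFT (no y) => yx; rewrite yx andbT.
Qed.

Definition upper_inv P (u : points3 n) : points3 n :=
  if u is inl x then inl (mate P x) else u.

Definition lower_inv Q (u : points3 n) : points3 n :=
  match u with
  | inl (inl i) => u
  | inl (inr i) => lower (mate Q (inl i))
  | inr i => lower (mate Q (inr i))
  end.

Lemma lower_invE Q x : lower_inv Q (lower x) = lower (mate Q x).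
Proof. by case: x. Qed.

Lemma lower_inj : injective (@lower n).
Proof. by move=> [x|x] [y|y] //= [->]. Qed.

Lemma upper_invK P : is_partial_brauer P -> involutive (upper_inv P).
Proof. by move=> /mateK mK [x|x] //=; rewrite mK. Qed.

Lemma lower_invK Q : is_partial_brauer Q -> involutive (lower_inv Q).
Proof.
by move=> /mateK mK [[x|x]|x] //=; rewrite lower_invE mK.
Qed.

Lemma connect_stack P Q : is_partial_brauer P -> is_partial_brauer Q ->
  connect (stack P Q) =2 connect (step2 (upper_inv P) (lower_inv Q)).
Proof.
move=> pbP pbQ u v; apply/idP/idP; apply: connect_sub => {}u {}v.
  case/orP=> /push_relP[x [y [-> ->]]]; rewrite same_blockE //.
    case/orP=> /eqP->; [exact: connect0|apply: connect1].
    by rewrite /step2 /= eqxx.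
  case/orP=> /eqP->; [exact: connect0|apply: connect1].
  by rewrite /step2 lower_invE eqxx orbT.
have lowerP x : connect (stack P Q) (lower x) (lower (mate Q x)).
  apply/connect1/orP; right; apply/push_relP.
  by exists x, (mate Q x); split=> //; apply: mate_block.
case/orP=> /eqP->.
  case: u => [x|i] /=; last exact: connect0.
  apply/connect1/orP; left; apply/push_relP.
  by exists x, (mate P x); split=> //; apply: mate_block.
case: u => [[i|i]|i] /=; first exact: connect0.
  exact: (lowerP (inl i)).
exact: (lowerP (inr i)).
Qed.

Lemma end2_outer P Q x : end2 (upper_inv P) (lower_inv Q) (outer x).
Proof. by case: x => i; rewrite /end2 /= eqxx ?orbT. Qed.

Lemma outer_inj : injective (@outer n).
Proof. by move=> [x|x] [y|y] //= [->]. Qed.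

Lemma mem_pblock_mul P Q x y :
  (y \in pblock (blocks (partition_mul P Q)) x) =
  connect (stack P Q) (outer x) (outer y).
Proof. exact: same_block_mul. Qed.

Lemma partial_brauer_mul : mulg_closed is_partial_brauer.
Proof.
move=> P Q pbP pbQ.
change (is_partial_brauer (partition_mul P Q)).
rewrite /is_partial_brauer (forall_blocks _ (fun k => k <= 2)%N).
apply/forallP=> x; rewrite (cardsD1 x).
have -> : x \in pblock (blocks (partition_mul P Q)) x by apply: same_block_refl.
rewrite add1n ltnS; apply/card_le1_eqP => y z; rewrite !inE.
move=> /andP[yx xy] /andP[zx xz]; apply: outer_inj.
apply: (end2_uniq (upper_invK pbP) (lower_invK pbQ) (end2_outer P Q x)).
- by rewrite -connect_stack //; rewrite -mem_pblock_mul.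
- by rewrite -connect_stack //; rewrite -mem_pblock_mul.
- by rewrite (inj_eq outer_inj).
- by rewrite (inj_eq outer_inj).
- exact: end2_outer.
- exact: end2_outer.
Qed.

Lemma brauer_mul : mulg_closed is_brauer.
Proof.
move=> P Q bP bQ; have pbP := brauer_partial bP; have pbQ := brauer_partial bQ.
have : is_partial_brauer (partition_mul P Q) := partial_brauer_mul pbP pbQ.
change (is_partial_brauer (partition_mul P Q) -> is_brauer (partition_mul P Q)).
rewrite /is_brauer /is_partial_brauer.
rewrite (forall_blocks _ (fun k => k <= 2)%N) (forall_blocks _ (fun k => k == 2)).
move=> /forallP le2; apply/forallP=> x; move: (le2 x) => {le2}.
set B := pblock _ x => le2.
have Bx : x \in B by apply: same_block_refl.
have Bgt0 : (0 < #|B|)%N by apply/card_gt0P; exists x.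
suff : ~~ odd #|B| by case: #|B| le2 Bgt0 => [|[|[|k]]].
set C := [set u | connect (stack P Q) (outer x) u].
have BC : @outer n @: B = C :&: [set outer y | y in [set: points n]].
  apply/setP=> u; rewrite !inE; apply/imsetP/andP => [[y By ->]|[Cu /imsetP[y _ ey]]].
    split; last by apply: imset_f; rewrite inE.
    by rewrite -mem_pblock_mul.
  by exists y => //; rewrite /B mem_pblock_mul -ey.
pose up (u : points3 n) := if u is inl x then true else false.
pose lo (u : points3 n) := if u is inl (inl x) then false else true.
have Cup : ~~ odd #|C :&: [set u | up u]|.
  apply: (even_card_involution (upper_invK pbP)) => u; rewrite !inE.
    case/andP=> Cu; case: u Cu => //= u Cu _; rewrite andbT.
    apply: connect_trans Cu (connect1 _); apply/orP; left; apply/push_relP.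
    by exists u, (mate P u); split=> //; apply: mate_block.
  case/andP=> _; case: u => //= u _.
  by apply/negP=> /eqP[/eqP]; apply/negP/mate_neq.
have Clo : ~~ odd #|C :&: [set u | lo u]|.
  have loP u : lo u -> exists y, u = lower y.
    by case: u => [[i|i]|i] //= _; [exists (inl i)|exists (inr i)].
  apply: (even_card_involution (lower_invK pbQ)) => u; rewrite !inE.
    case/andP=> Cu /loP[y ey]; subst u; rewrite lower_invE.
    apply/andP; split; last by case: (mate Q y).
    apply: connect_trans Cu (connect1 _); apply/orP; right; apply/push_relP.
    by exists y, (mate Q y); split=> //; apply: mate_block.
  case/andP=> _ /loP[y ->]; rewrite lower_invE (inj_eq lower_inj).
  exact: mate_neq.
rewrite -(card_imset _ outer_inj) BC.
have splitC A : #|C| = (#|C :&: A| + #|C :\: A|)%N by rewrite cardsID.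
have eU : @outer n @: [set: points n] = ~: [set u | up u] :|: ~: [set u | lo u].
  apply/setP=> u; rewrite !inE; apply/imsetP/idP => [[[i|i] _ ->] //|].
  by rewrite /up /lo; case: u => [[i|i]|i] //= _; [exists (inl i)|exists (inr i)]; rewrite ?inE.
have -> : #|C :&: @outer n @: [set: points n]| =
          (#|C :\: [set u | up u]| + #|C :\: [set u | lo u]|)%N.
  rewrite eU setIUr -!setDE cardsU.
  suff -> : (C :\: [set u | up u]) :&: (C :\: [set u | lo u]) = set0.
    by rewrite cards0 subn0.
  by apply/setP=> -[[i|i]|i]; rewrite !inE /up /lo /= ?andbF.
have := congr1 odd (splitC [set u | up u]).
have := congr1 odd (splitC [set u | lo u]).
rewrite !oddD (negbTE Cup) (negbTE Clo) /= => <- <-.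
by rewrite addbb.
Qed.

End Brauer.

Definition partial_brauer (n : nat) : Type :=
  {P : partition_semigroup n | is_partial_brauer P}.

HB.instance Definition _ n := SubFinite.on (partial_brauer n).
HB.instance Definition _ n :=
  SubChoice_isSubSemigroup.Build _ _ (partial_brauer n) (@partial_brauer_mul n).

Definition brauer (n : nat) : Type :=
  {P : partition_semigroup n | is_brauer P}.

HB.instance Definition _ n := SubFinite.on (brauer n).
HB.instance Definition _ n :=
  SubChoice_isSubSemigroup.Build _ _ (brauer n) (@brauer_mul n).

(* Main.v *)
Require Import Defs.
From HB Require Import structures.
From mathcomp Require Import all_boot all_fingroup.

Set Implicit Arguments.
Unset Strict Implicit.
Unset Printing Implicit Defensive.

Local Open Scope group_scope.

(** A diagram in which every block has at most two elements is an involution of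
    the 2n points, and mates in a product are found by following paths.

    Lower bound. Let S have a nontrivial subgroup H with neutral element u and
    an idempotent e with u * e = e = e * u. If S divides an iterated wreath
    product with m groups, then m > 0, and the part of e * S * e generated by
    the conjugates of e under H divides one with m - 1 groups
    ([complexity_drop]). Indeed the elements of H have lifts with a common
    component a in the innermost factor A0, because A0 is aperiodic, and e has
    an idempotent lift whose component x in A0 is fixed by a. The lifts of
    the idempotents h * e * h^-1 can be chosen idempotent; they then act
    trivially on the innermost group as well. So they fix a state of the two
    innermost factors, and evaluating there removes both factors. In the Brauer
    semigroup one takes for H the permutations of the points not used by k
    disjoint hooks, and for e the product of k + 1 disjoint hooks. The conjugates
    of e generate the next group and the next idempotent, a transposition being
    obtained by moving a hook around ([hook_tperm]), and this can be repeated
    as long as two points are left ([hooks_depth]).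

    Upper bound. A semigroup is decomposed by computing its products with a
    cascade of automata: group layers correspond to the group factors, and
    layers without cycles to the aperiodic ones ([simulates_divides]). For the
    Brauer semigroup itself the classical decomposition along the ranks
    n, n - 2, ... works: a level keeps a factor of its own rank, and hands
    the product down when the rank drops. The partial Brauer semigroup has
    all the ranks n, n - 1, ..., and hence about twice as many J-classes with
    nontrivial groups. Here every partial diagram p is completed to a Brauer
    diagram w, and each level keeps both a product w of completions and the
    product p of the original factors, whose edges are among those of w. No
    further group is needed for p: while the rank of w is constant, the edges of
    w meeting the upper row can only get lost in p, and the other ones are
    determined by the last factor. At the bottom the ranks are at most one, and
    no group is left. This is [ranked_cover_tower], stated for abstract
    semigroups with involution, and applied in [partial_brauer_tower]. *)

(** * Powers of semigroups and towers of wreath products *)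

Definition power (I : finType) (S : finSemigroupType) : finSemigroupType :=
  HB.pack {ffun I -> S} (Finite.on {ffun I -> S}) (Semigroup.on {ffun I -> S}).

Definition group_power (I : finType) (G : finGroupType) : finGroupType :=
  HB.pack {ffun I -> G} (Finite.on {ffun I -> G}) (Group.on {ffun I -> G}).

Lemma is_subgroup_image (S T : finSemigroupType) (f : S -> T) (H : {set S}) :
  {in H &, {morph f : x y / x * y}} -> is_subgroup H -> is_subgroup (f @: H).
Proof.
move=> fM [clH [e He eP]]; split.
  move=> _ _ /imsetP[x Hx ->] /imsetP[y Hy ->].
  by rewrite -fM // imset_f // clH.
exists (f e); first exact: imset_f.
move=> _ /imsetP[x Hx ->]; have [ex xe [y Hy [xy yx]]] := eP x Hx.
rewrite -!fM // ex xe; split=> //; exists (f y); first exact: imset_f.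
by rewrite -!fM // xy yx.
Qed.

Lemma aperiodic_power (I : finType) (S : finSemigroupType) :
  aperiodic S -> aperiodic (power I S).
Proof.
move=> aS H sH; have [_ [e He _]] := sH; apply/eqP/cards1P; exists e.
apply/setP=> f; rewrite inE; apply/idP/eqP => [Hf|-> //].
apply/ffunP=> i; pose ev (g : power I S) := g i.
have /eqP/cards1P[a ea] : #|ev @: H| = 1%N.
  by apply/aS/is_subgroup_image => // g h _ _; rewrite /ev ffunE.
have inE1 g : g \in H -> g i = a.
  by move=> Hg; apply/set1P; rewrite -ea; apply: imset_f.
by rewrite !inE1.
Qed.

(** Only the two outermost factors are named at a time, so that both bounds can
    proceed by induction on the number of groups. *)
Fixpoint tower (m : nat) (W : finSemigroupType) : Prop :=
  if m is k.+1 then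
    exists (A : finSemigroupType) (G : finGroupType) (W' : finSemigroupType),
      [/\ aperiodic A, tower k W' & W = wreath A (wreath G W')]
  else aperiodic W.

Lemma eq_iter_wreath A A' G G' m :
    (forall i, (i <= m)%N -> A i = A' i) ->
    (forall i, (i <= m)%N -> G i = G' i) ->
  iter_wreath A G m = iter_wreath A' G' m.
Proof.
elim: m => [|m IH] eA eG /=; first exact: eA.
rewrite IH => [|i im|i im]; [|exact/eA/leqW|exact/eG/leqW].
by rewrite eA // eG.
Qed.

Lemma tower_iter_wreath A G m : (forall i, (i <= m)%N -> aperiodic (A i)) ->
  tower m (iter_wreath A G m).
Proof.
elim: m => [|m IH] aA /=; first exact: aA.
exists (A m.+1), (G m.+1), (iter_wreath A G m); split=> //; first exact: aA.
by apply: IH => i im; apply: aA; apply: leqW.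
Qed.

Lemma towerP m W : tower m W ->
  exists A G, (forall i, (i <= m)%N -> aperiodic (A i)) /\ W = iter_wreath A G m.
Proof.
elim: m W => [|m IH] W /=.
  by move=> aW; exists (fun=> W), (fun=> perm_of unit : finGroupType).
move=> [A [G [W' [aA /IH[A' [G' [aA' ->]]] ->]]]].
exists (fun i => if i == m.+1 then A else A' i).
exists (fun i => if i == m.+1 then G else G' i); split.
  by move=> i; case: eqVneq => // ne le; apply: aA'; rewrite -ltnS ltn_neqAle ne.
rewrite /= eqxx; congr (wreath _ (wreath _ _)).
by apply: eq_iter_wreath => i im; rewrite ltn_eqF.
Qed.

Lemma decomposableP S m :
  decomposable S m <-> exists W, tower m W /\ divides S W.
Proof.
split=> [[A [G [aA dS]]]|[W [/towerP[A [G [aA ->]]] dS]]]; last by exists A, G.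
by exists (iter_wreath A G m); split=> //; apply: tower_iter_wreath.
Qed.

(** * Idempotent powers and subgroups *)

Section Powers.
Variable S : finSemigroupType.
Implicit Types x y : S.

(* The power of x with exponent k.+1: there need not be a neutral element. *)
Definition pow x k := iter k (mulg x) x.

Lemma powS x k : pow x k.+1 = x * pow x k.
Proof. by []. Qed.

Lemma powD x j k : pow x j * pow x k = pow x (j + k).+1.
Proof. by elim: j => [|j IH] //; rewrite addSn !powS -mulgA IH. Qed.

Lemma pow_closed (U : {set S}) x k :
  {in U &, forall a b, a * b \in U} -> x \in U -> pow x k \in U.
Proof. by move=> clU Ux; elim: k => [|k IH] //; rewrite powS clU. Qed.

Lemma pow_idem x k : x * x = x -> pow x k = x.
Proof. by move=> xx; elim: k => [|k] //; rewrite powS => ->. Qed.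

Lemma exists_idempotent_pow x : exists k, pow x k * pow x k = pow x k.
Proof.
have : ~~ injectiveb (fun i : 'I_#|S|.+1 => pow x i).
  by apply/injectiveP => /leq_card; rewrite card_ord ltnn.
case/injectivePn=> i [j]; wlog ij : i j / i < j => [hw ne e|_ e].
  case: (ltngtP i j) => [lt|lt|/val_inj eij]; first exact: hw lt ne e.
    by apply: hw lt _ _; rewrite // eq_sym.
  by rewrite eij eqxx in ne.
pose p := (j - i)%N; have p0 : (0 < p)%N by rewrite subn_gt0.
have per m : (i <= m)%N -> pow x (m + p) = pow x m.
  elim: m => [|m IH].
    by rewrite leqn0 => /eqP i0; rewrite add0n /p i0 subn0 -e i0.
  rewrite leq_eqVlt => /orP[/eqP<-|]; first by rewrite subnKC // ltnW.
  by rewrite ltnS => /IH em; rewrite addSn !powS em.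
have pers t m : (i <= m)%N -> pow x (m + t * p) = pow x m.
  move=> im; elim: t => [|t IH]; first by rewrite addn0.
  by rewrite mulSnr addnA per // (leq_trans im) // leq_addr.
exists (i.+1 * p).-1; rewrite powD -addSn prednK ?muln_gt0 // addnC pers //.
by rewrite -ltnS prednK ?muln_gt0 // leq_pmulr.
Qed.

End Powers.

Lemma morph_pow (S T : finSemigroupType) (U : {set S}) (f : S -> T) x k :
    {in U &, forall a b, a * b \in U} -> {in U &, {morph f : a b / a * b}} ->
  x \in U -> f (pow x k) = pow (f x) k.
Proof.
move=> clU fM Ux; elim: k => [|k IH] //.
by rewrite !powS fM ?IH // pow_closed.
Qed.

(** A subgroup of a quotient is the image of a subgroup: take a minimal local
    subsemigroup eRe of the preimage R, in which every idempotent power is e. *)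
Lemma lift_subgroup (S W : finSemigroupType) (U : {set W}) (f : W -> S)
    (H : {set S}) :
    {in U &, forall x y, x * y \in U} -> {in U &, {morph f : x y / x * y}} ->
    is_subgroup H -> H \subset f @: U ->
  exists2 K : {set W}, is_subgroup K & (K \subset U) /\ f @: K = H.
Proof.
move=> clU fM [clH [u Hu uP]] /subsetP HU.
pose R := [set w in U | f w \in H].
have clR : {in R &, forall x y, x * y \in R}.
  move=> x y; rewrite !inE => /andP[Ux Hx] /andP[Uy Hy].
  by rewrite clU //= fM // clH.
pose K e := [set w in R | (e * w == w) && (w * e == w)].
have KP e w : reflect [/\ w \in R, e * w = w & w * e = w] (w \in K e).
  have -> : (w \in K e) = [&& w \in R, e * w == w & w * e == w].
    by rewrite /K in_set.
  by apply: (iffP and3P) => -[h /eqP h1 /eqP h2]; split=> //; apply/eqP.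
have [e1 /andP[Re1 /eqP e11]] : exists e, (e \in R) && (e * e == e).
  have /imsetP[w Uw uw] := HU u Hu; have [k kk] := exists_idempotent_pow w.
  have Rw : w \in R by rewrite inE Uw -uw.
  by exists (pow w k); rewrite kk eqxx pow_closed.
have i1 : (e1 \in R) && (e1 * e1 == e1) by rewrite Re1 e11 eqxx.
have := @arg_minnP _ e1 (fun e => (e \in R) && (e * e == e))
  (fun e => #|K e|) i1.
case=> e /andP[Re /eqP ee] mine {e1 Re1 e11 i1}.
have Ke : e \in K e by apply/KP.
have powe x : x \in K e -> exists k, pow x k = e.
  move=> /KP[Rx ex xe]; have [k kk] := exists_idempotent_pow x; exists k.
  set g := pow x k in kk *.
  have Rg : g \in R by apply: pow_closed.
  have eg : e * g = g by rewrite /g; case: (k) => [|j] //; rewrite powS mulgA ex.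
  have ge : g * e = g.
    by rewrite /g; elim: (k) => [|j IH] //; rewrite powS -mulgA IH.
  have sKg : K g \subset K e.
    apply/subsetP=> w /KP[Rw gw wg]; apply/KP; split=> //.
      by rewrite -gw mulgA eg.
    by rewrite -wg -mulgA ge.
  have /eqP eK : K g == K e.
    by rewrite eqEcard sKg mine // Rg kk eqxx.
  by move: Ke; rewrite -eK => /KP[_ <- _].
have clK : {in K e &, forall x y, x * y \in K e}.
  move=> x y /KP[Rx ex xe] /KP[Ry ey ye]; apply/KP; split; first exact: clR.
    by rewrite mulgA ex.
  by rewrite -mulgA ye.
exists (K e).
  split=> //; exists e => // x Kx; have [Rx ex xe] := KP _ _ Kx; split=> //.
  have [k kx] := powe x Kx; exists (pow x (k + k)); first exact: pow_closed.
  split; first by rewrite -powS -powD kx.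
  by rewrite -[x in _ * x]/(pow x 0) powD addn0 -powD kx.
have RU w : w \in R -> w \in U /\ f w \in H by rewrite inE => /andP[].
split; first by apply/subsetP=> w /KP[/RU[]].
have [Ue He] := RU e Re.
have feu : f e = u.
  have [_ _ [y Hy [ey _]]] := uP _ He.
  have [_ h _] := uP _ He.
  by rewrite -h -ey mulgA -fM // ee.
apply/setP=> h; apply/imsetP/idP => [[w /KP[/RU[_ Hw] _ _] ->] //|Hh].
have /imsetP[w Uw hw] := HU h Hh.
have Rw : w \in R by rewrite inE Uw -hw.
have [uh hu _] := uP _ Hh.
exists (e * w * e); last by rewrite !fM ?clU // feu -hw uh hu.
apply/KP; split; first by rewrite !clR.
  by rewrite !mulgA ee.
by rewrite -!mulgA ee.
Qed.

(** * Removing the two innermost factors of a tower *)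

(** The states s b of W are acted upon by D as if only the values in W'
    mattered. *)
Definition evaluation (W W' : finSemigroupType) (D : pred W) (ev : W -> W')
    (s : option W' -> W) : Prop :=
  {in D &, {morph ev : x y / x * y}} /\
  forall b w, w \in D -> s (mul_adjoin b (ev w)) = s b * w.

Lemma mul_adjoinA (T : finSemigroupType) (x : option T) (t u : T) :
  mul_adjoin (mul_adjoin x t) u = mul_adjoin x (t * u).
Proof. by case: x => [y|] //; rewrite /mul_adjoin mulgA. Qed.

Section WreathEvaluation.
Variables (X W W' : finSemigroupType) (D : pred W) (ev : W -> W').
Variables (s : option W' -> W) (f0 : {ffun option W -> X}).

(** An element p is read at every state s b. The prefix y that precedes the
    state is arbitrary, and so X has to be replaced by one of its powers. *)
Definition wreath_ev (p : wreath X W) : wreath (power (option W) X) W' :=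
  ([ffun b => [ffun y => p.1 (mul_adjoin y (s b))]], ev p.2).

Definition wreath_state (b : option (wreath (power (option W) X) W')) :
    wreath X W :=
  if b is Some p then ([ffun y => f0 y * p.1 None y], s (Some p.2))
  else (f0, s None).

Lemma wreath_evaluation : evaluation D ev s ->
  evaluation [pred p : wreath X W | p.2 \in D] wreath_ev wreath_state.
Proof.
move=> [evM sM]; split=> [p q /= Dp Dq|b p Dp].
  congr (_, _); last exact: evM.
  apply/ffunP=> b; rewrite !ffunE; apply/ffunP=> y.
  by rewrite !ffunE /= sM // mul_adjoinA.
case: b => [[k a]|].
  congr (_, _); last exact: (sM (Some a) _ Dp).
  by apply/ffunP=> y; rewrite !ffunE /= mulgA.
congr (_, _); last exact: (sM None _ Dp).
by apply/ffunP=> y; rewrite !ffunE.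
Qed.

End WreathEvaluation.

(** The elements stabilizing a state of the wreath product of the two innermost
    factors act through a tower with one group less. *)
Lemma tower_evaluation m W : tower m.+1 W ->
  exists (A0 : finSemigroupType) (G : finGroupType) (pr : W -> wreath G A0),
    [/\ aperiodic A0, {morph pr : x y / x * y} &
      forall z, exists (W' : finSemigroupType) (ev : W -> W') s,
        [/\ tower m W', s None = z &
            evaluation [pred w | pr z * pr w == pr z] ev s]].
Proof.
elim: m W => [|m IH] W.
  move=> [A [G [A0 [aA aA0 ->]]]]; exists A0, G, snd; split=> // z.
  pose T := wreath G A0.
  pose ev (w : wreath A T) : power (option T) A :=
    [ffun y => w.1 (mul_adjoin y z.2)].
  pose s (b : option (power (option T) A)) : wreath A T :=
    if b is Some k then ([ffun y => z.1 y * k y], z.2) else z.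
  exists (power (option T) A), ev, s; split=> //; first exact: aperiodic_power.
  split=> [p q /eqP Dp /eqP Dq|b p /eqP Dp].
    by apply/ffunP=> y; rewrite !ffunE mul_adjoinA Dp.
  case: b => [k|]; congr (_, _) => //; apply/ffunP=> y; rewrite !ffunE //.
  by rewrite mulgA.
move=> [A [G [W1 [aA /IH[A0 [G0 [pr [aA0 prM zP]]]] ->]]]].
exists A0, G0, (fun w => pr w.2.2); split=> // [x y|z]; first by rewrite -prM.
have [W' [ev [s [tW' s0 evs]]]] := zP z.2.2.
have h1 := wreath_evaluation z.2.1 evs.
have h2 := wreath_evaluation z.1 h1.
eexists; exists (wreath_ev (wreath_ev ev s) (wreath_state s z.2.1)).
exists (wreath_state (wreath_state s z.2.1) z.1); split=> //.
  exists (power (option (wreath G W1)) A), (group_power (option W1) G), W'.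
  by split=> //; apply: aperiodic_power.
by rewrite /= s0; case: (z) => ? [? ?].
Qed.

Definition covers (S W : finSemigroupType) (X : {set S}) : Prop :=
  exists (U : {set W}) (f : W -> S),
    [/\ {in U &, forall x y, x * y \in U},
        {in U &, {morph f : x y / x * y}} & X \subset f @: U].

Inductive generated (S : finSemigroupType) (E : S -> Prop) : S -> Prop :=
| Generated1 x of E x : generated E x
| GeneratedM x y of generated E x & generated E y : generated E (x * y).

(** An idempotent has trivial group components at the states that its second
    component stabilizes. *)
Lemma stabilize_wreath (G : finGroupType) (A : finSemigroupType)
    (p q : wreath G A) : p.2 * q.2 = p.2 -> q * q = q -> p * q = p.
Proof.
case: p q => [g x] [h a] /= xa qq; congr (_, _) => //; apply/ffunP=> y.
rewrite ffunE /=; suff -> : h (mul_adjoin y x) = 1 by rewrite mulg1.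
have /ffunP/(_ (mul_adjoin y x)) := congr1 fst qq.
by rewrite ffunE /= mul_adjoinA xa => /(canRL (mulKg _)); rewrite mulVg.
Qed.

(** If H is nontrivial and e lies below its neutral element u, then the elements
    of e * S * e generated by the conjugates of e are covered with one group
    less: idempotents have idempotent lifts, which act trivially on a group. *)
Lemma complexity_drop (S W : finSemigroupType) (H : {set S}) (u e : S) m :
    is_subgroup H -> #|H| != 1%N -> u \in H -> {in H, forall h, u * h = h} ->
    e * e = e -> u * e = e -> e * u = e -> tower m W -> covers W (e |: H) ->
  exists k (W' : finSemigroupType), [/\ m = k.+1, tower k W' &
    forall X : {set S},
      {in X, forall x, [/\ e * x = x, x * e = x &
         generated (fun c => exists h h',
           [/\ h \in H, h' \in H, h' * h = u & c = h * e * h']) x]} ->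
      covers W' X].
Proof.
move=> sH H1 Hu uH ee ue eu tW [U [f [clU fM /subsetP HU]]].
have [|K sK [/subsetP KU fK]] := lift_subgroup clU fM sH.
  by apply/subsetP=> h Hh; apply: HU; rewrite inE Hh orbT.
case: m tW => [|m] tW.
  have /eqP/cards1P[w wK] := tW K sK.
  by case/negP: H1; rewrite -fK wK imset_set1 cards1.
have [A0 [G [pr [aA0 prM zP]]]] := tower_evaluation tW.
pose pr0 w := (pr w).2.
have pr0M : {morph pr0 : x y / x * y} by move=> x y; rewrite /pr0 prM.
(* A subgroup covering H has a trivial image in the aperiodic factor A0. *)
have [a prK] : exists a, {in K, forall w, pr0 w = a}.
  have /eqP/cards1P[a aK] : #|pr0 @: K| = 1%N.
    by apply/aA0/is_subgroup_image => // x y _ _; apply: pr0M.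
  by exists a => w Kw; apply/set1P; rewrite -aK imset_f.
have [_ [e0 Ke0 e0P]] := sK.
have Ue0 := KU _ Ke0.
have fe0 : f e0 = u.
  have Hfe0 : f e0 \in H by rewrite -fK imset_f.
  move: Hu; rewrite -fK => /imsetP[v Kv uv].
  have [_ ve _] := e0P v Kv.
  by rewrite uv -[in RHS]ve fM ?KU // -uv uH.
have /imsetP[we Uwe fwe] : e \in f @: U by apply: HU; rewrite inE set11.
have [k] := exists_idempotent_pow (e0 * we); set q := pow _ _ => qq.
have Up : e0 * we \in U by rewrite clU.
have Uq : q \in U by rewrite pow_closed.
have e0e0 : e0 * e0 = e0 by have [] := e0P _ Ke0.
have e0q : e0 * q = q.
  by rewrite /q; case: (k) => [|j]; rewrite ?powS !mulgA e0e0.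
(* This idempotent lift z of e is stabilized by e0 on the right. Thus its
   component x in A0 is stabilized by a, and so by the lifts of H. *)
pose z := q * e0.
have Uz : z \in U by rewrite clU.
have fz : f z = e.
  by rewrite fM // (morph_pow _ clU fM) // fM // fe0 -fwe ue pow_idem.
have zz : z * z = z by rewrite /z mulgA -(mulgA q) e0q qq.
have ze0 : z * e0 = z by rewrite /z -mulgA e0e0.
clearbody z.
pose x := pr0 z.
have xa : x * a = x by rewrite -(prK _ Ke0) -pr0M ze0.
have xx : x * x = x by rewrite -pr0M zz.
have [W' [ev [s [tW' s0 [evM sM]]]]] := zP z.
exists m, W'; split=> // X XP.
set D := (D in {in D &, _}) in evM sM.
have DE w : (w \in D) = (pr z * pr w == pr z) by [].
have clD : {in D &, forall v w, v * w \in D}.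
  by move=> v w; rewrite !DE prM mulgA => /eqP-> /eqP->.
have lift c : generated (fun c => exists h h',
    [/\ h \in H, h' \in H, h' * h = u & c = h * e * h']) c ->
    exists w, [/\ w \in U, w \in D & f w = c].
  elim=> [{}c [h [h' [Hh Hh' h'h ->]]]|c1 c2 _ [w1 [U1 D1 <-]] _ [w2 [U2 D2 <-]]].
    move: Hh Hh' h'h; rewrite -fK => /imsetP[w Kw ->] /imsetP[w' Kw' ->] h'h.
    have [j] := exists_idempotent_pow (w * z * w'); set v := pow _ _ => vv.
    have [Uw Uw'] := (KU _ Kw, KU _ Kw').
    have Uwz : w * z \in U by exact: clU.
    have Uwzw : w * z * w' \in U by exact: clU.
    exists v; split; first by rewrite pow_closed.
      rewrite DE; apply/eqP/stabilize_wreath; last by rewrite -prM vv.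
      have xw : x * pr0 (w * z * w') = x.
        by rewrite !pr0M (prK w) // (prK w') // -/x !mulgA xa xx xa.
      rewrite -/(pr0 _) -/(pr0 _) -/x /v.
      elim: (j) => [|i IH]; first exact: xw.
      by rewrite powS pr0M mulgA xw.
    rewrite (morph_pow _ clU fM) // !fM // fz pow_idem //.
    by rewrite -!mulgA (mulgA (f w')) h'h (mulgA u) ue (mulgA e) ee.
  by exists (w1 * w2); split; [exact: clU|exact: clD|exact: fM].
pose U0 := [set w in U | [&& w \in D, e * f w == f w & f w * e == f w]].
have U0P w : w \in U0 -> [/\ w \in U, w \in D, e * f w = f w & f w * e = f w].
  by rewrite inE => /and4P[? ? /eqP ? /eqP ?].
pose f' w := f (s (Some w)).
have f'E w : w \in U0 -> f' (ev w) = f w.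
  move=> /U0P[Uw Dw efw _].
  by rewrite /f' -[Some _]/(mul_adjoin None _) sM // s0 fM // fz.
have U0M : {in U0 &, forall v w, v * w \in U0}.
  move=> v w /U0P[Uv Dv efv fve] /U0P[Uw Dw efw fwe'].
  rewrite inE fM //; apply/and4P; split; [exact: clU|exact: clD| |].
    by rewrite mulgA efv.
  by rewrite -mulgA fwe'.
exists (ev @: U0), f'; split.
- move=> _ _ /imsetP[v U0v ->] /imsetP[w U0w ->].
  have [_ Dv _ _] := U0P _ U0v; have [_ Dw _ _] := U0P _ U0w.
  by rewrite -evM // imset_f // U0M.
- move=> _ _ /imsetP[v U0v ->] /imsetP[w U0w ->].
  have [Uv Dv _ _] := U0P _ U0v; have [Uw Dw _ _] := U0P _ U0w.
  by rewrite -evM // !f'E ?U0M // fM.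
apply/subsetP=> c Xc; have [ec ce /lift[w [Uw Dw fw]]] := XP _ Xc.
have U0w : w \in U0 by rewrite inE Uw Dw fw ec ce !eqxx.
by apply/imsetP; exists (ev w); [exact: imset_f|rewrite f'E].
Qed.

(** * Transformations without cycles *)

Definition transformation (Y : finType) : Type := {ffun Y -> Y}.

HB.instance Definition _ (Y : finType) := Finite.on (transformation Y).

Section Transformations.
Variable Y : finType.
Implicit Types f g : transformation Y.

(* Transformations act on the right. *)
Definition transformation_mul f g : transformation Y := [ffun y => g (f y)].

Lemma transformation_mulA : associative transformation_mul.
Proof. by move=> f g h; apply/ffunP=> y; rewrite !ffunE. Qed.

HB.instance Definition _ :=
  isSemigroup.Build (transformation Y) transformation_mulA.

Definition subtransformations (V : {pred transformation Y})
  of mulg_closed V : Type := {f : transformation Y | f \in V}.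

Section Subsemigroup.
Variables (V : {pred transformation Y}) (clV : mulg_closed V).
HB.instance Definition _ := SubFinite.on (subtransformations clV).
HB.instance Definition _ :=
  SubChoice_isSubSemigroup.Build _ _ (subtransformations clV) clV.
End Subsemigroup.

Definition acyclic f := forall k y, iter k.+1 f y = y -> f y = y.

Definition acyclic_class (V : {pred transformation Y}) :=
  mulg_closed V /\ {in V, forall f, acyclic f}.

(** An element of a group of transformations permutes the image of the neutral
    element; without cycles it fixes all of that image. *)
Lemma aperiodic_subtransformations V (clV : mulg_closed V) :
  {in V, forall f, acyclic f} ->
  aperiodic (subtransformations clV : finSemigroupType).
Proof.
move=> acV H [clH [e He eP]]; apply/eqP/cards1P; exists e.
apply/setP=> h; rewrite inE; apply/idP/eqP=> [Hh|-> //].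
have [k hk] := exists_idempotent_pow h.
have {hk} hk : pow h k = e.
  have Hk : pow h k \in H by apply: pow_closed.
  have [_ ke [g Hg [kg _]]] := eP _ Hk.
  by rewrite -ke -kg mulgA hk.
have powE j y : val (pow h j) y = iter j.+1 (val h) y.
  by elim: j y => [|j IH] y //; rewrite powS iterSr -IH /= ffunE.
have valM (f g : subtransformations clV) y : val (f * g) y = val g (val f y).
  by rewrite /= ffunE.
have [eh _ _] := eP _ Hh; have [ee _ _] := eP _ He.
apply/val_inj/ffunP=> y; rewrite -[in LHS]eh valM.
by apply: (acV _ (valP h) k); rewrite -powE hk -valM ee.
Qed.

End Transformations.

Section Monotone.
Variables (Y : finType) (le : rel Y).
Hypotheses (le_refl : reflexive le) (le_trans : transitive le).
Hypothesis le_anti : antisymmetric le.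

(** The changes of a memory that can be reset, and loses information between
    two resets. *)
Definition constant_or_decreasing : {pred transformation Y} :=
  [pred f : transformation Y |
    [exists c, forall y, f y == c] || [forall y, le (f y) y]].

Lemma constant_or_decreasing_class : acyclic_class constant_or_decreasing.
Proof.
split=> [f g|f].
  rewrite !inE => /orP[/existsP[c /forallP fc]|/forallP fd].
    move=> _; apply/orP; left; apply/existsP; exists (g c); apply/forallP => y.
    by rewrite ffunE (eqP (fc y)).
  case/orP=> [/existsP[c /forallP gc]|/forallP gd].
    apply/orP; left; apply/existsP; exists c.
    by apply/forallP => y; rewrite ffunE.
  by apply/orP; right; apply/forallP=> y; rewrite ffunE (le_trans (gd _)).
rewrite inE => /orP[/existsP[c /forallP fc]|/forallP fd] k y.
  by rewrite iterS (eqP (fc _)) => <-; rewrite (eqP (fc _)).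
rewrite iterSr => e; apply: le_anti; rewrite fd -[X in le X _]e /=.
elim: k (f y) {e} => [|k IH] z; first exact: le_refl.
by rewrite iterS (le_trans (fd _)).
Qed.

End Monotone.

Section Triangular.
Variables (Y1 Y2 : finType) (V1 : {pred transformation Y1}).
Variable V2 : {pred transformation Y2}.

Definition triangular : {pred transformation (Y2 * Y1)%type} :=
  [pred f : transformation (Y2 * Y1)%type |
    [exists g : transformation Y1, exists h : {ffun Y1 -> transformation Y2},
      [&& g \in V1, [forall y, h y \in V2] &
          [forall y, f y == (h y.2 y.1, g y.2)]]]].

Lemma triangularP (f : transformation (Y2 * Y1)%type) : reflect
  (exists (g : transformation Y1) (h : Y1 -> transformation Y2),
     [/\ g \in V1, forall y, h y \in V2 & forall y, f y = (h y.2 y.1, g y.2)])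
  (f \in triangular).
Proof.
rewrite inE; apply: (iffP existsP) => [[g /existsP[h /and3P[Vg Vh fE]]]|].
  move/forallP: Vh => Vh; move/forallP: fE => fE.
  by exists g, h; split=> // y; apply/eqP.
move=> [g [h [Vg Vh fE]]]; exists g; apply/existsP; exists [ffun y => h y].
by apply/and3P; split=> //; apply/forallP => y; rewrite ?ffunE ?fE.
Qed.

(** Two consecutive layers without cycles amount to one: adjacent aperiodic
    factors of a wreath product are merged in this way. *)
Lemma triangular_class :
  acyclic_class V1 -> acyclic_class V2 -> acyclic_class triangular.
Proof.
move=> [cl1 ac1] [cl2 ac2]; split=> [f f'|f].
  move=> /triangularP[g [h [Vg Vh fE]]] /triangularP[g' [h' [Vg' Vh' fE']]].
  apply/triangularP; exists (g * g'), (fun y => h y * h' (g y)).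
  split=> [|y|y]; [exact: cl1|exact: cl2|].
  by rewrite !ffunE fE' fE.
move=> /triangularP[g [h [Vg Vh fE]]] k [y2 y1] fy.
have it2 j : (iter j f (y2, y1)).2 = iter j g y1.
  by elim: j => [|j IH] //; rewrite !iterS fE /= IH.
have gy : g y1 = y1 by apply: (ac1 _ Vg k); rewrite -it2 fy.
have itg j : iter j g y1 = y1 by elim: j => [|j IH] //; rewrite iterS IH.
have it1 j : (iter j f (y2, y1)).1 = iter j (h y1) y2.
  by elim: j => [|j IH] //; rewrite !iterS fE /= IH it2 itg.
by rewrite fE /= gy (ac2 _ (Vh y1) k) // -it1 fy.
Qed.

End Triangular.

Lemma right_mul_class (S : finSemigroupType) (K : {pred S}) :
    mulg_closed K ->
    {in K, forall q, forall k p, iter k.+1 (mulg^~ q) p = p -> p * q = p} ->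
  acyclic_class
    [pred f : transformation S | [exists q in K, f == [ffun p => p * q]]].
Proof.
move=> clK acK; split=> [f g|f].
  move=> /exists_inP[q Kq /eqP->] /exists_inP[r Kr /eqP->].
  apply/exists_inP; exists (q * r); first exact: clK.
  by apply/eqP/ffunP=> p; rewrite !ffunE mulgA.
move=> /exists_inP[q Kq /eqP->] k p; rewrite ffunE => e.
apply: (acK q Kq k); rewrite -[RHS]e; apply: eq_iter => z; by rewrite ffunE.
Qed.

(** * Cascades of automata *)

Section Automata.
Variable L : finType.

Definition cascade (Y Q : Type) (v : Q -> L -> Y -> Y) (d : Q -> L -> Q)
    (s : Y * Q) (a : L) : Y * Q :=
  (v s.2 a s.1, d s.2 a).

Lemma cascade_snd (Y Q : Type) (v : Q -> L -> Y -> Y) (d : Q -> L -> Q) s u :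
  (foldl (cascade v d) s u).2 = foldl d s.2 u.
Proof. by elim: u s => [|a u IH] s //=; rewrite IH. Qed.

Definition value (W : finSemigroupType) (phi : L -> W) (u : seq L) : option W :=
  foldl (fun x a => mul_adjoin x (phi a)) None u.

(** The state reached by reading a word depends only on its value in W. *)
Definition simulates (W : finSemigroupType) (Q : Type) (d : Q -> L -> Q) q0 :=
  exists (phi : L -> W) (psi : option W -> Q),
    forall u, psi (value phi u) = foldl d q0 u.

(** The function component of a value is used at None only, since words are read
    from the initial state. *)
Lemma simulates_wreath (X T : finSemigroupType) (Q Y : Type)
    (d : Q -> L -> Q) q0 (act : Y -> X -> Y) (v : Q -> L -> X) y0 :
    (forall y x x', act y (x * x') = act (act y x) x') ->
    simulates T d q0 ->
  simulates (wreath X T) (cascade (fun q a y => act y (v q a)) d) (y0, q0).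
Proof.
move=> actM [phi [psi psiE]].
pose phi2 a : wreath X T := ([ffun x => v (psi x) a], phi a).
pose psi2 (x : option (wreath X T)) :=
  if x is Some p then (act y0 (p.1 None), psi (Some p.2)) else (y0, psi None).
exists phi2, psi2 => u.
suff [] : psi2 (value phi2 u) =
            foldl (cascade (fun q a y => act y (v q a)) d) (y0, q0) u /\
          omap snd (value phi2 u) = value phi u by [].
have psi22 x : (psi2 x).2 = psi (omap snd x) by case: x.
elim/last_ind: u => [|u a [IH1 IH2]]; first by rewrite /= (psiE [::]).
have := psiE (rcons u a).
rewrite /value -cats1 !foldl_cat /= -!/(value _ _) -psiE -IH1 -IH2.
rewrite /cascade psi22; move: (value phi2 u) => x <-.
by case: x {IH1 IH2} => [[F t]|] /=; rewrite !ffunE /= ?actM.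
Qed.

Definition group_simulated k (Q : finType) (d : Q -> L -> Q) q0 : Prop :=
  if k is j.+1 then
    exists (G : finGroupType) (W : finSemigroupType),
      tower j W /\ simulates (wreath G W) d q0
  else forall q, q = q0.

(** A cascade with k group layers. The topmost layer v, which has no cycles, is
    kept apart from the rest d', so that further such layers can be merged
    into it. *)
Definition cascade_depth k (Q : Type) (d : Q -> L -> Q) q0 : Prop :=
  exists (Q' : finType) (d' : Q' -> L -> Q') q0' (Y : finType)
         (V : {pred transformation Y}) (v : Q' -> L -> Y -> Y) y0
         (h : Y * Q' -> Q),
    [/\ group_simulated k d' q0', acyclic_class V,
        forall q a, finfun (v q a) \in V &
        forall u, h (foldl (cascade v d') (y0, q0') u) = foldl d q0 u].

Lemma cascade_depth_map k (Q R : Type) (d : Q -> L -> Q) q0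
    (d' : R -> L -> R) r0 (h : Q -> R) :
    (forall u, h (foldl d q0 u) = foldl d' r0 u) ->
  cascade_depth k d q0 -> cascade_depth k d' r0.
Proof.
move=> hE [Q' [d1 [q1 [Y [V [v [y0 [h' [sQ acV Vv h'E]]]]]]]]].
exists Q', d1, q1, Y, V, v, y0, (h \o h'); split=> // u.
by rewrite /= h'E hE.
Qed.

Definition unit_transformation : {pred transformation unit} := predT.

Lemma acyclic_class_unit : acyclic_class unit_transformation.
Proof. by split=> // f _ k []; case: (f tt). Qed.

Lemma cascade_depth_unit : cascade_depth 0 (fun (q : unit) (_ : L) => q) tt.
Proof.
exists unit, (fun q _ => q), tt, unit, unit_transformation.
exists (fun _ _ y => y), tt, snd.
split; [by case|exact: acyclic_class_unit|by []|].
by move=> u; case: (foldl _ _ _) => y []; case: (foldl _ _ _).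
Qed.

Lemma cascade_depth_tower k (Q : Type) (d : Q -> L -> Q) q0 :
  cascade_depth k d q0 -> exists W, tower k W /\ simulates W d q0.
Proof.
move=> [Q' [d' [q0' [Y [V [v [y0 [h [sQ [clV acV] Vv hE]]]]]]]]].
pose X : finSemigroupType := subtransformations clV.
have aX : aperiodic X by apply: aperiodic_subtransformations.
pose vX q a : X := Sub (finfun (v q a)) (Vv q a).
pose act y (x : X) := (val x : transformation Y) y.
have actM y (x x' : X) : act y (x * x') = act (act y x) x'.
  by rewrite /act /= ffunE.
have actv q a y : act y (vX q a) = v q a y by rewrite /act SubK ffunE.
case: k sQ => [|k] /= sQ.
  exists X; split=> //; exists (vX q0').
  exists (fun x => h (if x is Some f then act y0 f else y0, q0')) => u.
  rewrite -hE; congr h; elim/last_ind: u => [|u a IH] //.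
  rewrite /value -cats1 !foldl_cat /= -!/(value _ _) -IH /cascade /=.
  congr (_, _); last by rewrite (sQ (d' _ _)).
  by case: (value _ _) => [f|] /=; rewrite ?actM actv.
have [G [W [tW sW]]] := sQ; exists (wreath X (wreath G W)).
split; first by exists X, G, W.
have [phi [psi psiE]] := simulates_wreath vX y0 actM sW.
exists phi, (fun x => h (psi x)) => u; rewrite psiE -hE; congr h.
elim: u (y0, q0') => [|a u IH] s //=; rewrite -IH; congr foldl.
by rewrite /cascade actv.
Qed.

Lemma cascade_depth_acyclic k (Q : Type) (d : Q -> L -> Q) q0 (Y : finType)
    (V : {pred transformation Y}) (v : Q -> L -> Y -> Y) y0 :
    acyclic_class V -> (forall q a, finfun (v q a) \in V) ->
  cascade_depth k d q0 -> cascade_depth k (cascade v d) (y0, q0).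
Proof.
move=> cV Vv [Q' [d' [q0' [Y' [V' [v' [y0' [h [sQ cV' Vv' hE]]]]]]]]].
pose w q a (y : Y * Y') := (v (h (y.2, q)) a y.1, v' q a y.2).
exists Q', d', q0', (Y * Y')%type, (triangular V' V), w, (y0, y0').
exists (fun s => (s.1.1, h (s.1.2, s.2))); split=> //.
- exact: triangular_class.
- move=> q a; apply/triangularP; exists (finfun (v' q a)).
  by exists (fun y => finfun (v (h (y, q)) a)); split=> // y; rewrite !ffunE.
suff hw u : let s := foldl (cascade w d') (y0, y0', q0') u in
    (s.1.2, s.2) = foldl (cascade v' d') (y0', q0') u /\
    s.1.1 = (foldl (cascade v d) (y0, q0) u).1.
  move=> u; have [e1 e2] := hw u; rewrite e1 e2 hE.
  by rewrite -(cascade_snd v d (y0, q0)) -surjective_pairing.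
elim/last_ind: u => [|u a [IH1 IH2]] //.
rewrite -cats1 !foldl_cat /= /w -IH2 IH1 hE -IH1; split=> //.
by rewrite cascade_snd.
Qed.

Lemma cascade_depth_group k (Q : finType) (d : Q -> L -> Q) q0
    (G : finGroupType) (v : Q -> L -> G) :
    cascade_depth k d q0 ->
  cascade_depth k.+1 (cascade (fun q a g => g * v q a) d) (1, q0).
Proof.
move=> dQ; have [W [tW sW]] := cascade_depth_tower dQ.
exists (G * Q)%type, (cascade (fun q a g => g * v q a) d), (1, q0).
exists unit, unit_transformation, (fun _ _ y => y), tt, snd.
split; [|exact: acyclic_class_unit|by []|].
  exists G, W; split=> //; apply: simulates_wreath => // y x x'; exact: mulgA.
by move=> u; rewrite cascade_snd.
Qed.

End Automata.

Lemma simulates_divides (S W : finSemigroupType) (one : S) :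
  left_id one mulg -> simulates W (mulg : S -> S -> S) one -> divides S W.
Proof.
move=> one1 [phi [psi psiE]].
pose r (x y : option W) := [exists a, y == mul_adjoin x (phi a)].
have rP x : reflect (exists u, value phi u = x) (connect r None x).
  apply: (iffP connectP) => [[p rp ->]|[u <-]].
    elim/last_ind: p rp => [|p y IH]; first by exists [::].
    rewrite rcons_path last_rcons => /andP[/IH[u <-] /existsP[a /eqP->]].
    by exists (rcons u a); rewrite /value -cats1 foldl_cat.
  elim/last_ind: u => [|u a [p rp e]]; first by exists [::].
  exists (rcons p (mul_adjoin (value phi u) (phi a))); last first.
    by rewrite last_rcons /value -cats1 foldl_cat.
  by rewrite rcons_path rp -e; apply/existsP; exists a.
have foldM u y x : foldl (fun x a => mul_adjoin x (phi a)) (mul_adjoin x y) u =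
    if foldl (fun x a => mul_adjoin x (phi a)) (Some y) u is Some z
    then mul_adjoin x z else None.
  by elim: u y => [|a u IH] y //=; rewrite mul_adjoinA IH.
have value_cat x y u v : value phi u = Some x -> value phi v = Some y ->
    value phi (u ++ v) = Some (x * y).
  rewrite /value foldl_cat => -> ; case: v => [|a v] //= e.
  by rewrite -/(mul_adjoin (Some x) (phi a)) foldM e.
have foldM1 u (x y : S) : foldl mulg (x * y) u = x * foldl mulg y u.
  by elim: u y => [|a u IH] y //=; rewrite -mulgA IH.
exists [set x | connect r None (Some x)], (fun x => psi (Some x)); split.
- move=> x y; rewrite !inE => /rP[u ux] /rP[v vy]; apply/rP.
  by exists (u ++ v); apply: value_cat.
- move=> x y; rewrite !inE => /rP[u ux] /rP[v vy].
  rewrite -(value_cat _ _ _ _ ux vy) -ux -vy !psiE foldl_cat.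
  case: v vy => [|a v] //= _; by rewrite foldM1 one1.
apply/setP=> a; rewrite inE; apply/imsetP; exists (phi a).
  by rewrite inE; apply/rP; exists [:: a].
by rewrite -[Some _]/(value phi [:: a]) psiE /= one1.
Qed.

(** * Decomposing along the ranks *)

Lemma perm_extend (T : finType) (A : {set T}) (f : T -> T) :
  {in A &, injective f} -> exists c : {perm T}, {in A, c =1 f}.
Proof.
have [m] := ubnP #|A|; elim: m A => // m IH A ltAm fI.
have [->|[x Ax]] := set_0Vmem A; first by exists 1 => y; rewrite inE.
have [|y z|c cf] := IH (A :\ x).
- by rewrite (cardsD1 x) Ax add1n ltnS in ltAm.
- by rewrite !inE => /andP[_ Ay] /andP[_ Az]; apply: fI.
exists (c * tperm (c x) (f x)) => y Ay; rewrite permM.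
have [->|yx] := eqVneq y x; first by rewrite tpermL.
have cy : c y = f y by apply: cf; rewrite !inE yx.
rewrite cy tpermD //; first by rewrite -cy (inj_eq perm_inj) eq_sym.
by apply: contra_neq yx => /fI-> //.
Qed.

(** The semigroup P is to be decomposed. Its elements p are covered by elements
    x of the semigroup B, as expressed by sub p x. Both are regular and have an
    involution, and B has a rank function whose fibres behave like J-classes: by
    mul_cancelB, a factor x is recovered from a product x * y of the same rank.
    The sets up p and low p are the traces of p on the left and on the right
    side, and K consists of the elements left to the last layer. *)
Section RankedCover.
Variables (B P : finSemigroupType) (oneB : B) (oneP : P).
Variables (starB : B -> B) (starP : P -> P) (rk : B -> nat) (N : nat).
Variables (sub : P -> B -> bool) (I : finType) (up low : P -> {set I}).
Variables (comp : P -> B) (K : {pred P}).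

Hypotheses (mul1B : left_id oneB mulg) (mul1P : left_id oneP mulg).
Hypothesis mulP1 : right_id oneP mulg.
Hypotheses (starBK : involutive starB)
  (starB_mul : forall x y, starB (x * y) = starB y * starB x)
  (mul_starB : forall x, x * starB x * x = x)
  (mul_starP : forall p, p * starP p * p = p).
Hypotheses (rk_max : forall x, rk x <= N)
  (rk_mul : forall x y, rk (x * y) <= rk x)
  (rk_star : forall x, rk (starB x) = rk x)
  (mul_cancelB : forall x y, rk (x * y) = rk x ->
                 x * y * starB (x * y) * x = x).
Hypotheses (sub1 : sub oneP oneB)
  (subM : forall p q x y, sub p x -> sub q y -> sub (p * q) (x * y))
  (sub_star : forall p x, sub p x -> sub (starP p) (starB x)).
Hypotheses (up_mul : forall p q, up (p * q) \subset up p)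
  (low_mul : forall p q x y, sub p x -> sub q y -> rk (x * y) = rk y ->
             low (p * q) = low q)
  (code_inj : forall p q x, sub p x -> sub q x -> up p = up q -> low p = low q ->
              p = q).
Hypothesis sub_comp : forall p, sub p (comp p).
Hypotheses (closedK : mulg_closed K) (K1 : oneP \in K)
  (sub0K : forall p x, sub p x -> rk x = 0%N -> p \in K)
  (acyclicK : {in K, forall q, forall k p,
                iter k.+1 (mulg^~ q) p = p -> p * q = p}).

Implicit Types (x y w l : B) (p q : P).

Lemma starB_proj x : starB (starB x * x) = starB x * x.
Proof. by rewrite starB_mul starBK. Qed.

Lemma rk_mulr x y : rk (x * y) <= rk y.
Proof. by rewrite -rk_star starB_mul -(rk_star y) rk_mul. Qed.

Lemma rk_proj x : rk (starB x * x) = rk x.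
Proof.
apply/eqP; rewrite eqn_leq rk_mulr -{1}(mul_starB x) -mulgA.
exact: rk_mulr.
Qed.

(** Elements of the same L-class have the same projection starB x * x. *)
Lemma proj_mulr x y : rk (x * y) = rk y ->
  starB (x * y) * (x * y) = starB y * y.
Proof.
move=> rxy; set a := starB y; set b := starB x.
have rab : rk (a * b) = rk a by rewrite -starB_mul !rk_star.
have -> : starB (x * y) = a * b by rewrite starB_mul.
have -> : x * y = starB (a * b) by rewrite -[LHS]starBK starB_mul.
have -> : y = starB a by rewrite /a starBK.
have e1 : a * b * starB (a * b) * (a * starB a) = a * starB a.
  by rewrite mulgA mul_cancelB.
have e2 : a * starB a * (a * b * starB (a * b)) = a * b * starB (a * b).
  by rewrite !mulgA mul_starB.
rewrite -[RHS]e1 -[LHS]starBK starB_mul starBK -[in LHS]e2.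
by rewrite !starB_mul !starBK !mulgA.
Qed.

Lemma proj_mul w l : starB w * w = starB l * l -> w = w * starB l * l.
Proof. by move=> e; rewrite -mulgA -e mulgA mul_starB. Qed.

Lemma rk_mul_eq w l y : starB w * w = starB l * l -> rk (w * y) = rk (l * y).
Proof.
have le w' l' : starB w' * w' = starB l' * l' -> rk (w' * y) <= rk (l' * y).
  by move=> /proj_mul->; rewrite -[_ * l' * y]mulgA rk_mulr.
by move=> e; apply/eqP; rewrite eqn_leq !le.
Qed.

(** As l is recovered from l * y by a right multiplication, so is every element
    of the L-class of l. *)
Lemma mul_injective l y : rk (l * y) = rk l ->
  {in [set w | starB w * w == starB l * l] &, injective (mulg^~ y)}.
Proof.
move=> rly.
have back w : w \in [set w | starB w * w == starB l * l] ->
    w = w * y * (starB (l * y) * l).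
  rewrite inE => /eqP/proj_mul e.
  by rewrite [in LHS]e -[X in _ * X = _](mul_cancelB rly) [in RHS]e !mulgA.
move=> w w' /back e /back e' /= ww'.
by rewrite e e' ww'.
Qed.

(** A permutation of all of B inducing the multiplication by y on the L-class of
    l: right multiplications which keep the rank are left to a group layer. *)
Definition transport l y : {perm B} :=
  odflt 1 [pick c : {perm B} |
             [forall w, (starB w * w == starB l * l) ==> (c w == w * y)]].

Lemma transportE l y w : rk (l * y) = rk l -> starB w * w = starB l * l ->
  transport l y w = w * y.
Proof.
move=> rly e; rewrite /transport; case: pickP => [c /forallP/(_ w)|no] /=.
  by rewrite e eqxx => /eqP.
have [c cE] := perm_extend (mul_injective rly).
case/negP: (negbT (no c)); apply/forallP => v; apply/implyP => h.
by rewrite cE // inE.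
Qed.

Definition rebuild x (U L : {set I}) : P :=
  odflt oneP [pick p | [&& sub p x, up p == U & low p == L]].

Lemma rebuildE p x : sub p x -> rebuild x (up p) (low p) = p.
Proof.
move=> px; rewrite /rebuild; case: pickP => [q /and3P[qx /eqP uq /eqP lq]|no] /=.
  exact: code_inj qx px uq lq.
by have := no p; rewrite px !eqxx.
Qed.

Local Notation BP := (B * P)%type.
Implicit Types (s z : BP).

Let one2 : BP := (oneB, oneP).
Definition mul2 s z : BP := (s.1 * z.1, s.2 * z.2).

Section Level.
Variable r : nat.

(** The content s of level r is a product of letters which has rank r, or the
    neutral element. When the rank drops, level_out hands s * z down to the next
    level. The content becomes the projection of z, a right identity for z,
    rather than the neutral element: in this way the L-class of the new content
    does not depend on the old one, and the layer that keeps track of it has no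
    cycles. *)
Definition level_next s z : BP :=
  if z == one2 then s else
  if rk z.1 < r then one2 else
  if rk (s.1 * z.1) == r then mul2 s z
  else (starB z.1 * z.1, starP z.2 * z.2).

Definition level_out s z : BP :=
  if z == one2 then one2 else
  if rk z.1 < r then mul2 s z else
  if rk (s.1 * z.1) == r then one2
  else mul2 s z.

Definition admissible k z := sub z.2 z.1 && ((z == one2) || (rk z.1 <= k)).

Lemma level_mul s z : (level_out s z).2 * (level_next s z).2 = s.2 * z.2.
Proof.
rewrite /level_out /level_next; case: eqVneq => [->|_].
  by rewrite /= mul1P mulP1.
case: ifP => _; first by rewrite /= mulP1.
case: ifP => _; first by rewrite /= mul1P.
by rewrite /= -mulgA (mulgA z.2) mul_starP.
Qed.

Lemma level_out_admissible s z : sub s.2 s.1 -> admissible r z ->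
  0 < r -> admissible r.-1 (level_out s z).
Proof.
move=> ss /andP[sz /orP zr] r0; rewrite /level_out.
have adm1 : admissible r.-1 one2 by rewrite /admissible sub1 eqxx.
have admM : rk (s.1 * z.1) < r -> admissible r.-1 (mul2 s z).
  move=> lt; rewrite /admissible subM //=; apply/orP; right.
  by rewrite -ltnS prednK.
case: eqVneq => [//|zn1].
case: ifP => [zlt|_]; first by apply/admM/leq_ltn_trans/zlt/rk_mulr.
case: eqVneq => [//|ne]; apply: admM; rewrite ltn_neqAle ne.
case: zr => [/eqP z1|zr]; first by rewrite z1 eqxx in zn1.
exact: leq_trans (rk_mulr _ _) zr.
Qed.

Lemma level_next_sub s z : sub s.2 s.1 -> sub z.2 z.1 ->
  sub (level_next s z).2 (level_next s z).1.
Proof.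
move=> ss sz; rewrite /level_next; case: ifP => // _; case: ifP => // _.
by case: ifP => _; apply: subM => //; apply: sub_star.
Qed.

Definition last_next s z : BP :=
  if z == one2 then s else if rk z.1 < r then one2 else z.

Definition stays (l z : BP) : bool :=
  [&& rk l.1 == r, rk z.1 == r & rk (l.1 * z.1) == r].

Definition restart (l z : BP) : BP :=
  if rk z.1 < r then one2 else
  if rk l.1 == r then (starB z.1 * z.1, starP z.2 * z.2) else z.

(** The content s of a level is encoded in three layers. The lowest one is the
    last letter l, which is in the L-class of s; the second one is a permutation
    g, the product of the transports since the beginning; the third one stores
    an element x with g x = s.1, which is constant between two restarts, and the
    set up s.2, which is decreasing between two restarts. *)
Definition represents (t : (B * {set I}) * ({perm B} * BP)) s : Prop :=
  let: ((x, U), (g, l)) := t in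
  [/\ g x = s.1, U = up s.2, starB s.1 * s.1 = starB l.1 * l.1,
      low s.2 = low l.2 & rk l.1 = r \/ l = one2 /\ s = one2].

Definition decode (t : (B * {set I}) * ({perm B} * BP)) : BP :=
  let w := t.2.1 t.1.1 in (w, rebuild w t.1.2 (low t.2.2.2)).

Lemma decodeE t s : sub s.2 s.1 -> represents t s -> decode t = s.
Proof.
case: t => [[x U] [g l]] ss [gx -> _ ls _]; rewrite /decode /= gx -ls rebuildE //.
by case: s {gx ls ss}.
Qed.

Definition group_next (l z : BP) : {perm B} :=
  if (z != one2) && stays l z then transport l.1 z.1 else 1.

Definition store_next (gl : {perm B} * BP) z (xU : B * {set I}) : B * {set I} :=
  if z == one2 then xU else
  if stays gl.2 z then (xU.1, xU.2 :&: up ((decode (xU, gl)).2 * z.2))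
  else let t := restart gl.2 z in ((gl.1^-1)%g t.1, up t.2).

Lemma represents_next xU g (l : BP) s z : sub s.2 s.1 -> admissible r z ->
    represents (xU, (g, l)) s ->
  represents (store_next (g, l) z xU, (g * group_next l z, last_next l z))
             (level_next s z).
Proof.
move=> ss /andP[sz zr] rep; have dec := decodeE ss rep.
case: xU rep dec => x U [gx Uup pl sl lr] dec.
rewrite /store_next /group_next /last_next /level_next.
case: eqVneq zr => [_ _|zn1]; first by rewrite mulg1.
rewrite orFb => zr.
have rsl := rk_mul_eq z.1 pl.
have lowstar y q : sub q y -> low (starP q * q) = low q.
  by move=> qy; apply: (low_mul (sub_star qy) qy); rewrite rk_proj.
have projstar y : starB (starB y * y) * (starB y * y) = starB y * y.
  by rewrite starB_proj -mulgA (mulgA y) mul_starB.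
have [lt|ge] := ltnP (rk z.1) r.
  have -> : stays l z = false.
    by apply/negP => /and3P[_ /eqP e _]; rewrite e ltnn in lt.
  by rewrite mulg1 /restart lt; split; rewrite ?permKV //; right.
have {zr ge} zr : rk z.1 = r by apply/eqP; rewrite eqn_leq zr.
have [st|nst] := boolP (stays l z).
  have /and3P[/eqP lr' _ /eqP lzr] := st.
  have szr : rk (s.1 * z.1) = r by rewrite rsl.
  rewrite szr eqxx dec; split => /=.
  - by rewrite permM gx transportE // lr'.
  - by rewrite Uup; apply/setIidPr/up_mul.
  - by apply: proj_mulr; rewrite szr.
  - by apply: (low_mul ss sz); rewrite szr.
  by left.
rewrite mulg1 /restart zr ltnn.
have [lr'|lnr] := eqVneq (rk l.1) r.
  rewrite ifF; last first.
    by apply: contraNF nst => szr; rewrite /stays lr' zr -rsl (eqP szr) !eqxx.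
  by split; rewrite ?permKV //=; [exact: lowstar|left].
have [l1 s1] : l = one2 /\ s = one2.
  by case: lr => // e; rewrite e eqxx in lnr.
rewrite s1 /= mul1B zr eqxx /mul2 /= mul1B mul1P.
by split; rewrite ?permKV //=; left.
Qed.

Variables (Q : finType) (d : Q -> P -> Q) (q0 : Q) (out : Q -> P -> BP) (k : nat).
Hypothesis depth_d : cascade_depth k d q0.
Hypothesis out_admissible : forall u a, admissible r (out (foldl d q0 u) a).

Definition level_step : BP * Q -> P -> BP * Q :=
  cascade (fun (q : Q) a s => level_next s (out q a)) d.

Lemma level_step_sub u :
  sub (foldl level_step (one2, q0) u).1.2 (foldl level_step (one2, q0) u).1.1.
Proof.
elim/last_ind: u => [|u a IH]; first exact: sub1.
rewrite -cats1 foldl_cat /=; apply: level_next_sub => //.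
by rewrite cascade_snd; have /andP[] := out_admissible u a.
Qed.

Lemma cascade_depth_level : cascade_depth k.+1 level_step (one2, q0).
Proof.
pose d1 := cascade (fun (q : Q) a (l : BP) => last_next l (out q a)) d.
pose d2 := cascade (fun (t : BP * Q) a (g : {perm B}) =>
  g * group_next t.1 (out t.2 a)) d1.
pose d3 := cascade (fun (t : {perm B} * (BP * Q)) a xU =>
  store_next (t.1, t.2.1) (out t.2.2 a) xU) d2.
have D1 : cascade_depth k d1 (one2, q0).
  apply: cascade_depth_acyclic depth_d.
    apply: (@constant_or_decreasing_class _ eq_op) => //.
    - by move=> x y z /eqP->.
    - by move=> x y /andP[/eqP].
  move=> q a; rewrite inE /last_next.
  have [z1|z1] := eqVneq (out q a) one2.
    by apply/orP; right; apply/forallP=> y; rewrite ffunE.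
  by case: ifP => _; apply/orP; left; apply/existsP; [exists one2|exists (out q a)];
    apply/forallP=> y; rewrite ffunE.
have D2 : cascade_depth k.+1 d2 (1, (one2, q0)).
  exact: cascade_depth_group.
pose le (y y' : B * {set I}) := (y.1 == y'.1) && (y.2 \subset y'.2).
have D3 : cascade_depth k.+1 d3 ((oneB, up oneP), (1, (one2, q0))).
  apply: cascade_depth_acyclic D2.
    apply: (@constant_or_decreasing_class _ le).
    - by move=> y; rewrite /le eqxx subxx.
    - move=> y x z /andP[/eqP e1 s1] /andP[/eqP e2 s2].
      by rewrite /le e1 e2 eqxx (subset_trans s1 s2).
    - move=> [x U] [y V] /andP[/andP[/= /eqP-> UV] /andP[_ VU]].
      by congr (_, _); apply/eqP; rewrite eqEsubset UV.
  move=> q a; rewrite inE /store_next.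
  have [z1|z1] := eqVneq (out q.2.2 a) one2.
    by apply/orP; right; apply/forallP=> y; rewrite ffunE /le eqxx subxx.
  case st: (stays q.2.1 (out q.2.2 a)).
    by apply/orP; right; apply/forallP=> y; rewrite ffunE /le eqxx subsetIl.
  apply/orP; left; apply/existsP.
  exists (let t := restart q.2.1 (out q.2.2 a) in (q.1^-1 t.1, up t.2)).
  by apply/forallP => y; rewrite ffunE.
apply: (cascade_depth_map
  (h := fun t => (decode (t.1, (t.2.1, t.2.2.1)), t.2.2.2))) D3.
move=> u; pose next (q : Q) a s := level_next s (out q a).
suff [e rep] : let t := foldl d3 (oneB, up oneP, (1, (one2, q0))) u in
    t.2.2.2 = foldl d q0 u /\
    represents (t.1, (t.2.1, t.2.2.1)) (foldl level_step (one2, q0) u).1.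
  rewrite (decodeE (level_step_sub u) rep) e.
  by rewrite -(cascade_snd next d (one2, q0)) -surjective_pairing.
elim/last_ind: u => [|u a [IH1 IH2]].
  by split=> //; split; rewrite ?perm1 //=; right.
rewrite -cats1 !foldl_cat /=; split; first by rewrite IH1.
have := represents_next (level_step_sub u) (out_admissible u a) IH2.
by rewrite IH1 -[X in level_next _ (out X a)](cascade_snd next d (one2, q0)).
Qed.

End Level.

(** The product of the word read is the one of the contents of all levels, the
    lowest level being the leftmost factor; after k levels, what is handed down
    is neutral or has rank at most N - k. *)
Lemma cascade_levels k : k <= N ->
  exists (Q : finType) (d : Q -> P -> Q) (q0 : Q) (out : Q -> P -> BP)
         (tot : Q -> P),
    [/\ cascade_depth k d q0, tot q0 = oneP &
        forall u, let q := foldl d q0 u in forall a,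
          admissible (N - k) (out q a) /\ (out q a).2 * tot (d q a) = tot q * a].
Proof.
elim: k => [_|k IH kN].
  exists unit, (fun (q : unit) _ => q), tt, (fun _ a => (comp a, a)), (fun=> oneP).
  split=> // [|u q a]; first exact: cascade_depth_unit.
  by rewrite /= mul1P mulP1 subn0 /admissible /= sub_comp rk_max orbT.
have [Q [d [q0 [out [tot [D tot0 oP]]]]]] := IH (ltnW kN).
have outA u a : admissible (N - k) (out (foldl d q0 u) a).
  by have [] := oP u a.
pose d' := level_step (N - k) d out.
exists (BP * Q)%type, d', (one2, q0).
exists (fun (q : BP * Q) a => level_out (N - k) q.1 (out q.2 a)).
exists (fun q : BP * Q => q.1.2 * tot q.2).
split=> [||u q a].
- exact: cascade_depth_level.
- by rewrite /= mul1P.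
have q2 : q.2 = foldl d q0 u by apply: cascade_snd.
have [adm totM] := oP u a.
have q2S : (d' q a).2 = d (foldl d q0 u) a by rewrite -q2.
rewrite q2S q2; split.
  rewrite subnS; apply: level_out_admissible => //; last by rewrite subn_gt0.
  exact: (level_step_sub outA).
by rewrite /= mulgA q2 level_mul -!mulgA totM.
Qed.

Theorem ranked_cover_tower : exists W, tower N W /\ divides P W.
Proof.
have [Q [d [q0 [out [tot [D tot0 oP]]]]]] := cascade_levels (leqnn N).
pose last_mul (q : Q) (a p : P) := if (out q a).2 \in K then p * (out q a).2 else p.
have D' : cascade_depth N (cascade last_mul d) (oneP, q0).
  apply: cascade_depth_acyclic (right_mul_class closedK acyclicK) _ D => q a.
  rewrite inE; have [Kq|nKq] := boolP ((out q a).2 \in K).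
    by apply/exists_inP; exists (out q a).2 => //; apply/eqP/ffunP=> p;
       rewrite !ffunE /last_mul Kq.
  apply/exists_inP; exists oneP => //; apply/eqP/ffunP => p.
  by rewrite !ffunE /last_mul (negbTE nKq) mulP1.
have [W [tW sW]] : exists W, tower N W /\ simulates W (mulg : P -> P -> P) oneP.
  apply: cascade_depth_tower; apply: cascade_depth_map D'.
  move=> u; instantiate (1 := fun q : P * Q => q.1 * tot q.2).
  elim/last_ind: u => [|u a IH]; first by rewrite /= tot0 mulP1.
  rewrite -cats1 !foldl_cat /= -IH cascade_snd /=.
  have [/andP[so rko] totM] := oP u a.
  rewrite /last_mul ifT -?mulgA ?totM //.
  case/orP: rko => [/eqP-> //|]; rewrite subnn leqn0 => /eqP; exact: sub0K.
by exists W; split=> //; apply: simulates_divides sW.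
Qed.

End RankedCover.

(** * Partial Brauer diagrams as involutions *)

Section Diagrams.
Variable n : nat.
Local Notation PB := (partial_brauer n).
Implicit Types (x y : PB) (a b c : points n) (i j k l : 'I_n).

(** A partial Brauer diagram is the involution exchanging the elements of each
    block. *)
Definition mt x : points n -> points n := mate (val x).

Lemma mtK x : involutive (mt x).
Proof. exact: mateK (valP x). Qed.

Lemma same_mtE x a b : same_block (val x) a b = (b == a) || (b == mt x a).
Proof. exact: same_blockE (valP x). Qed.

Lemma mt_ext x y : mt x =1 mt y -> x = y.
Proof.
by move=> e; apply/val_inj/same_block_inj => a b; rewrite !same_mtE e.
Qed.

Lemma same_mt x a b : same_block (val x) a b -> b != a -> mt x a = b.
Proof. by rewrite same_mtE => /orP[/eqP-> /eqP|/eqP->]. Qed.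

Section Diagram.
Variable mu : points n -> points n.

Definition involution_partition : partition_semigroup n :=
  PartitionSemigroup (preim_partitionP (fun a => [set a; mu a]) setT).

Hypothesis muK : involutive mu.

Lemma same_involution_partition a b :
  same_block involution_partition a b = (b == a) || (b == mu a).
Proof.
rewrite /same_block /= pblock_equivalence_partition ?inE //; last first.
  by move=> c d e _ _ _; split=> // /eqP ->.
apply/eqP/orP => [/setP/(_ b)|[]/eqP->] //; rewrite ?inE ?eqxx //.
  by move/orP.
by rewrite muK setUC.
Qed.

Lemma partial_brauer_involution : is_partial_brauer involution_partition.
Proof.
rewrite /is_partial_brauer (forall_blocks _ (fun c : nat => c <= 2)%N).
apply/forallP=> a; apply: leq_trans (_ : #|[set a; mu a]| <= 2)%N; last first.
  by rewrite cards2 ltnS leq_b1.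
apply/subset_leq_card/subsetP => b; rewrite !inE.
by rewrite -same_involution_partition.
Qed.

Definition involution_diagram : PB := Sub _ partial_brauer_involution.

Lemma mt_involution : mt involution_diagram =1 mu.
Proof.
move=> a; have [e|ne] := eqVneq (mu a) a; last first.
  by apply: same_mt ne; rewrite same_involution_partition eqxx orbT.
have := mate_block (val involution_diagram) a.
by rewrite same_involution_partition e orbb => /eqP.
Qed.

End Diagram.

Definition flip a : points n := match a with inl i => inr i | inr i => inl i end.

Lemma flipK : involutive flip. Proof. by case. Qed.

Fact one_diagram_exists : {x : PB | mt x =1 flip}.
Proof. by exists (involution_diagram flipK); apply: mt_involution. Qed.

Fact star_exists x : {y : PB | mt y =1 flip \o mt x \o flip}.
Proof.
have muK : involutive (flip \o mt x \o flip) by move=> a; rewrite /= flipK mtK flipK.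
by exists (involution_diagram muK); apply: mt_involution.
Qed.

Definition one_diagram : PB := sval one_diagram_exists.

Definition star x : PB := sval (star_exists x).

Lemma mt1 a : mt one_diagram a = flip a.
Proof. exact: (svalP one_diagram_exists). Qed.

Lemma mt_star x a : mt (star x) a = flip (mt x (flip a)).
Proof. exact: (svalP (star_exists x)). Qed.

Lemma starK : involutive star.
Proof. by move=> x; apply: mt_ext => a; rewrite !mt_star !flipK. Qed.

Lemma same_mul x y a b : same_block (val (x * y)) a b =
  connect (stack (val x) (val y)) (outer a) (outer b).
Proof. exact: same_block_mul. Qed.

Definition linked x y := connect (stack (val x) (val y)).

Lemma linked_upper x y a : linked x y (upper a) (upper (mt x a)).
Proof.
apply/connect1/orP; left; apply/push_relP.
by exists a, (mt x a); split=> //; apply: mate_block.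
Qed.

Lemma linked_lower x y a : linked x y (lower a) (lower (mt y a)).
Proof.
apply/connect1/orP; right; apply/push_relP.
by exists a, (mt y a); split=> //; apply: mate_block.
Qed.

(** A path between two points of the outer rows exhibits their mates. *)
Lemma linked_mt x y a b : linked x y (outer a) (outer b) -> b != a ->
  mt (x * y) a = b.
Proof. by rewrite /linked -same_mul; apply: same_mt. Qed.

Lemma connect_in (T : finType) (r : rel T) (A : {set T}) u v :
  connect r u v -> u \in A -> (forall w z, w \in A -> r w z -> z \in A) -> v \in A.
Proof.
move=> /connectP[p rp ->] Au rA; elim: p u rp Au => [|w p IH] u //= /andP[uw rp] Au.
exact: IH rp (rA _ _ Au uw).
Qed.

Lemma mt_mul_upper x y i j : mt x (inl i) = inl j -> mt (x * y) (inl i) = inl j.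
Proof.
move=> xi; have [e|ne] := eqVneq j i; last first.
  apply: linked_mt; rewrite ?(inj_eq inl_inj) //.
  by have := linked_upper x y (inl i); rewrite xi.
subst j; have := mate_block (val (x * y)) (inl i); rewrite same_mul.
move=> /connect_in-/(_ [set inl (inl i)]); rewrite !inE => iso.
apply: outer_inj; apply/eqP/iso => // w u; rewrite !inE => /eqP->.
case/orP=> /push_relP[a [b [ea ->]]]; last by case: a ea.
by case: a ea => // k [<-]; rewrite same_mtE xi orbb => /eqP->.
Qed.

Lemma mt_mul_dead_end x y i j : mt x (inl i) = inr j -> mt y (inl j) = inl j ->
  mt (x * y) (inl i) = inl i.
Proof.
move=> xi yj; have := mate_block (val (x * y)) (inl i); rewrite same_mul.
move=> /connect_in-/(_ [set inl (inl i); inl (inr j)]); rewrite !inE eqxx => iso.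
have /orP[/eqP h|] : (outer (mt (x * y) (inl i)) == inl (inl i)) ||
    (outer (mt (x * y) (inl i)) == inl (inr j)); first 1 last.
- exact: (@outer_inj n _ (inl i) h).
- by case: (mt _ _).
apply: iso => // w u; rewrite !inE.
have xj : mt x (inr j) = inl i by rewrite -xi mtK.
case/orP=> /eqP-> /orP[] /push_relP[[k|k] [b [] //= [<-] ->]];
  by rewrite same_mtE ?xi ?xj ?yj => /orP[] /eqP->; rewrite eqxx ?orbT.
Qed.

Lemma mt_mul_transversal x y i j k :
  mt x (inl i) = inr j -> mt y (inl j) = inr k -> mt (x * y) (inl i) = inr k.
Proof.
move=> xi yj; apply: linked_mt => //.
apply: (connect_trans (linked_upper x y _)); rewrite xi.
by have := linked_lower x y (inl j); rewrite yj.
Qed.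

Lemma mt_mul_bounce x y i j k l :
    mt x (inl i) = inr j -> mt y (inl j) = inl k -> mt x (inr k) = inl l ->
  l != i -> mt (x * y) (inl i) = inl l.
Proof.
move=> xi yj xk li; apply: linked_mt; last by rewrite (inj_eq inl_inj).
apply: (connect_trans (linked_upper x y _)); rewrite xi.
apply: (connect_trans (linked_lower x y (inl j))); rewrite yj.
by have := linked_upper x y (inr k); rewrite xk.
Qed.

Lemma mt_mul_through x y i j k l m :
    mt x (inl i) = inr j -> mt y (inl j) = inl k -> mt x (inr k) = inr l ->
  mt y (inl l) = inr m -> mt (x * y) (inl i) = inr m.
Proof.
move=> xi yj xk yl; apply: linked_mt => //.
apply: (connect_trans (linked_upper x y _)); rewrite xi.
apply: (connect_trans (linked_lower x y (inl j))); rewrite yj.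
apply: (connect_trans (linked_upper x y (inr k))); rewrite xk.
by have := linked_lower x y (inl l); rewrite yl.
Qed.

Lemma same_star x a b :
  same_block (val (star x)) a b = same_block (val x) (flip a) (flip b).
Proof.
by rewrite !same_mtE mt_star (inj_eq (inv_inj flipK)) (can2_eq flipK flipK).
Qed.

Definition flip3 (u : points3 n) : points3 n :=
  match u with
  | inl (inl i) => inr i | inl (inr i) => inl (inr i) | inr i => inl (inl i)
  end.

Lemma linked_star x y u v :
  linked x y u v -> linked (star y) (star x) (flip3 u) (flip3 v).
Proof.
case/connectP=> p pP ->; rewrite /linked.
elim: p u pP => [|w p IH] u /=; first by rewrite connect0.
case/andP=> st /IH; apply/connect_trans/connect1.
have flip3U a : flip3 (upper a) = lower (flip a) by case: a.
have flip3L a : flip3 (lower a) = upper (flip a) by case: a.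
case/orP: st => /push_relP[a [b [-> -> ab]]]; apply/orP; [right|left];
  apply/push_relP; exists (flip a), (flip b).
  by rewrite !flip3U same_star !flipK.
by rewrite !flip3L same_star !flipK.
Qed.

Lemma star_mul x y : star (x * y) = star y * star x.
Proof.
have flip3O a : flip3 (outer a) = outer (flip a) by case: a.
have imp u v a b : same_block (val (u * v)) a b ->
    same_block (val (star v * star u)) (flip a) (flip b).
  by rewrite !same_mul -!flip3O; apply: linked_star.
apply/val_inj/same_block_inj => a b; rewrite same_star.
apply/idP/idP => [/imp|/imp]; first by rewrite !flipK.
by rewrite !starK.
Qed.

Lemma mt_mul_lower x y i j : mt y (inr i) = inr j -> mt (x * y) (inr i) = inr j.
Proof.
move=> yi; rewrite -(starK (x * y)) star_mul mt_star /= (@mt_mul_upper _ _ i j) //.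
by rewrite mt_star /= yi.
Qed.

Lemma mt_ext_half x y :
    (forall i, mt x (inl i) = mt y (inl i)) ->
    (forall i j, mt x (inr i) = inr j -> mt y (inr i) = inr j) ->
  x = y.
Proof.
move=> eU eL; apply: mt_ext => -[i|i]; first exact: eU.
case e: (mt x (inr i)) => [j|j]; last by rewrite (eL _ _ e).
by rewrite -(mtK y (inl j)) -eU -e mtK.
Qed.

(** A point of the upper row of y is reached straight through x, unless x
    already has the hook which y has there. *)
Lemma mul_left_unit x y :
    (forall i, mt x (inl i) = inr i \/
               exists2 j, mt x (inl i) = inl j & mt y (inl i) = inl j) ->
    (forall i, mt x (inr i) = inl i \/
               exists2 j, mt x (inr i) = inr j & mt y (inl i) = inl j) ->
  x * y = y.
Proof.
move=> xU xL; symmetry; apply: mt_ext_half => [i|i j]; last exact: mt_mul_lower.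
have [xi|[j xi ->]] := xU i; last by rewrite (mt_mul_upper _ xi).
case yi: (mt y (inl i)) => [j|j]; last by rewrite (mt_mul_transversal xi yi).
have [ji|ji] := eqVneq j i.
  by rewrite ji in yi *; rewrite (mt_mul_dead_end xi yi).
have [xj|[k xj yj]] := xL j; first by rewrite (mt_mul_bounce xi yi xj ji).
have yk : mt y (inl j) = inl i by rewrite -yi mtK.
move: yj; rewrite yk => -[ik]; subst k.
by have := mtK x (inr j); rewrite xj -[inr i]xi mtK.
Qed.

Lemma mul1x : left_id one_diagram mulg.
Proof. by move=> x; apply: mul_left_unit => i; left; rewrite mt1. Qed.

Lemma star1 : star one_diagram = one_diagram.
Proof. by apply: mt_ext => a; rewrite mt_star !mt1 flipK. Qed.

Lemma mulx1 : right_id one_diagram mulg.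
Proof. by move=> x; rewrite -(starK x) -star1 -star_mul mul1x. Qed.

Lemma mt_proj_upper x i :
  mt (x * star x) (inl i) = if mt x (inl i) is inl j then inl j else inr i.
Proof.
case xi: (mt x (inl i)) => [j|j]; first exact: mt_mul_upper.
by apply: (mt_mul_transversal xi); rewrite mt_star /= -xi mtK.
Qed.

Lemma star_proj x : star (x * star x) = x * star x.
Proof. by rewrite star_mul starK. Qed.

Lemma mt_proj_lower x i :
  mt (x * star x) (inr i) = if mt x (inl i) is inl j then inr j else inl i.
Proof. by rewrite -star_proj mt_star /= mt_proj_upper; case: (mt x _). Qed.

Lemma mul_proj x y :
    (forall i j, mt x (inl i) = inl j -> mt y (inl i) = inl j) ->
  x * star x * y = y.
Proof.
move=> xy; apply: mul_left_unit => i; rewrite ?mt_proj_upper ?mt_proj_lower;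
  by case xi: (mt x _) => [j|j]; [right; exists j; rewrite ?(xy _ _ xi)|left].
Qed.

Lemma mul_star x : x * star x * x = x.
Proof. exact: mul_proj. Qed.

Definition in_lower a : bool := if a is inr _ then true else false.

Definition transversals x : {set 'I_n} := [set i | in_lower (mt x (inl i))].

Definition rank x : nat := #|transversals x|.

Lemma rank_starW x : rank x <= rank (star x).
Proof.
pose f i := if mt x (inl i) is inr j then j else i.
have fE i : i \in transversals x -> mt x (inl i) = inr (f i).
  by rewrite inE /f; case: (mt x _).
rewrite /rank -(card_in_imset (f := f)).
  apply/subset_leq_card/subsetP=> _ /imsetP[i /fE xi ->].
  by rewrite inE mt_star /= -xi mtK.
move=> i j /fE xi /fE xj e; apply: inl_inj.
by apply: (inv_inj (mtK x)); rewrite xi xj e.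
Qed.

Lemma rank_star x : rank (star x) = rank x.
Proof.
apply/eqP; rewrite eqn_leq rank_starW andbT.
by have := rank_starW (star x); rewrite starK.
Qed.

Lemma transversals_mul x y : transversals (x * y) \subset transversals x.
Proof.
apply/subsetP=> i; rewrite !inE; case xi: (mt x (inl i)) => [j|//].
by rewrite (mt_mul_upper _ xi).
Qed.

Lemma rank_mul_l x y : rank (x * y) <= rank x.
Proof. exact/subset_leq_card/transversals_mul. Qed.

(** The upper hooks and the unmatched upper points of x persist in x * y; if
    no transversal is lost, there is no room for further ones. *)
Lemma mt_upper_rank x y i j : rank (x * y) = rank x ->
  mt (x * y) (inl i) = inl j -> mt x (inl i) = inl j.
Proof.
move=> rxy; have /setP/(_ i) : transversals (x * y) = transversals x.
  by apply/eqP; rewrite eqEcard transversals_mul -/(rank x) -rxy leqnn.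
rewrite !inE; case xi: (mt x (inl i)) => [k|k]; last by case: (mt _ _).
by rewrite (mt_mul_upper _ xi).
Qed.

Lemma mul_cancel x y : rank (x * y) = rank x -> x * y * star (x * y) * x = x.
Proof. by move=> rxy; apply: mul_proj => i j; apply: mt_upper_rank. Qed.

Lemma transversals_star_mul x y : rank (x * y) = rank y -> forall i j,
  mt (x * y) (inr i) = inr j -> mt y (inr i) = inr j.
Proof.
move=> rxy i j e; have := @mt_upper_rank (star y) (star x) i j.
rewrite -star_mul !rank_star !mt_star /= e => /(_ rxy erefl).
by case: (mt y _) => // k [->].
Qed.

(** Among the diagrams of rank at most one the right multiplications have no
    cycles: along such a cycle the upper hooks are constant, the lower hooks
    are those of q, and at most one transversal is left to be placed. *)
Lemma rank_le1_acyclic q : rank q <= 1 ->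
  forall m x, iter m.+1 (mulg^~ q) x = x -> x * q = x.
Proof.
move=> rq m x cyc.
have rk_iter t y : rank (iter t (mulg^~ q) y) <= rank y.
  by elim: t => [|t IH] //; rewrite iterS (leq_trans (rank_mul_l _ _)).
have rxq : rank (x * q) = rank x.
  by apply/eqP; rewrite eqn_leq rank_mul_l -{1}cyc iterSr rk_iter.
have [z xz] : exists z, x = z * q.
  by exists (iter m (mulg^~ q) x); rewrite -[LHS]cyc.
have uniq_j i j : in_lower (mt q (inr i)) = false ->
    in_lower (mt q (inr j)) = false -> i = j.
  move=> qi qj; have le1 : (#|transversals (star q)| <= 1)%N.
    by rewrite -/(rank _) rank_star.
  have qT l : in_lower (mt q (inr l)) = false -> l \in transversals (star q).
    by rewrite inE mt_star /=; case: (mt q _).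
  by apply: (card_le1_eqP le1); apply: qT.
have low1 y i : in_lower (mt q (inr i)) -> mt (y * q) (inr i) = mt q (inr i).
  by case e: (mt q (inr i)) => [j|j] // _; apply: mt_mul_lower.
have lowx i : in_lower (mt q (inr i)) -> mt x (inr i) = mt q (inr i).
  by rewrite xz; apply: low1.
have trans1 y i j : mt (y * q) (inl i) = inr j -> in_lower (mt q (inr j)) = false.
  move=> e; apply/negP => ql; have := low1 y _ ql.
  by rewrite -{1}e mtK => h; rewrite -h in ql.
have upE i : mt (x * q) (inl i) = mt x (inl i).
  case e: (mt x (inl i)) => [j|j]; first exact: mt_mul_upper.
  case e': (mt (x * q) (inl i)) => [l|l].
    by have := mt_upper_rank rxq e'; rewrite e.
  congr inr; apply: uniq_j; first exact: trans1 e'.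
  by move: e; rewrite xz; apply: trans1.
apply: mt_ext_half => // i j e.
have [qi|/negbTE qi] := boolP (in_lower (mt q (inr i))).
  by rewrite lowx // -e low1.
have single y l : mt (y * q) (inr i) = inr l -> l = i.
  move=> yi; apply: uniq_j => //; apply/negP => ql; have := low1 y _ ql.
  by rewrite -{1}yi mtK => h; move: qi; rewrite h mtK.
have ji := single _ _ e; subst j.
case x_i: (mt x (inr i)) => [l|l]; last first.
  by congr inr; apply: (single z); rewrite -xz.
have h : mt (x * q) (inl l) = inr i by rewrite upE -x_i mtK.
by have := mtK (x * q) (inl l); rewrite h e.
Qed.

Definition sub_diagram x y := [forall a, (mt x a == a) || (mt x a == mt y a)].

Lemma sub_diagramP x y :
  reflect (forall a, mt x a = a \/ mt x a = mt y a) (sub_diagram x y).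
Proof.
by apply: (iffP forallP) => h a; have := h a; [move=> /orP[]/eqP; [left|right]|
  move=> [] ->; rewrite eqxx ?orbT].
Qed.

Lemma sub_diagram_refl x : sub_diagram x x.
Proof. by apply/sub_diagramP; right. Qed.

Lemma sub_diagram_same x y : sub_diagram x y -> forall a b,
  same_block (val x) a b -> same_block (val y) a b.
Proof.
move=> /sub_diagramP xy a b; rewrite !same_mtE.
by have [->|->] := xy a; rewrite ?orbb => // ->.
Qed.

Lemma sub_diagramM x y z t :
  sub_diagram x z -> sub_diagram y t -> sub_diagram (x * y) (z * t).
Proof.
move=> xz yt; apply/sub_diagramP => a.
have [|ne] := eqVneq (mt (x * y) a) a; [by left|right].
symmetry; apply: same_mt ne; have := mate_block (val (x * y)) a.
rewrite !same_mul -/(mt _ _); apply: connect_sub => u v uv; apply: connect1.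
case/orP: uv => /push_relP[b [c [-> -> bc]]]; apply/orP; [left|right];
  by apply/push_relP; exists b, c; split=> //; apply: sub_diagram_same bc.
Qed.

Lemma sub_diagram_star x y : sub_diagram x y -> sub_diagram (star x) (star y).
Proof.
move=> /sub_diagramP xy; apply/sub_diagramP => a; rewrite !mt_star.
by have [->|->] := xy (flip a); [left; rewrite flipK|right].
Qed.

Lemma rank_sub_diagram x y : sub_diagram x y -> rank x <= rank y.
Proof.
move=> /sub_diagramP xy; apply/subset_leq_card/subsetP => i; rewrite !inE.
by have [->|->] := xy (inl i).
Qed.

Definition up x : {set 'I_n} := [set i | mt x (inl i) != inl i].

Definition low x : {set 'I_n} :=
  [set i | (mt x (inr i) != inr i) && in_lower (mt x (inr i))].

Lemma up_mul x y : up (x * y) \subset up x.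
Proof.
by apply/subsetP=> i; rewrite !inE; apply: contra_neq => /mt_mul_upper->.
Qed.

(** By the equality of ranks, the lower hooks of z * t are those of t; one of
    them which is missing in y has an unmatched end in x * y. *)
Lemma low_mul x y z t : sub_diagram x z -> sub_diagram y t ->
  rank (z * t) = rank t -> low (x * y) = low y.
Proof.
move=> xz yt rzt; apply/setP=> i; rewrite !inE.
case yi: (mt y (inr i)) => [j|j]; last by rewrite (mt_mul_lower _ yi).
case xyi: (mt (x * y) (inr i)) => [k|k]; first by rewrite !andbF.
rewrite andbT andbF; apply/negbTE; rewrite negbK; apply/negPn/negP => ki.
have /sub_diagramP/(_ (inr i)) := sub_diagramM xz yt.
rewrite xyi => -[e|e]; first by rewrite e eqxx in ki.
have ti := transversals_star_mul rzt (esym e).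
move/sub_diagramP: yt => /(_ (inr i)); rewrite yi ti.
by case.
Qed.

(** An edge of z is in x as soon as one of its ends is matched in x. An edge
    meeting the upper row is tested there, the other ones in the lower row. *)
Lemma code_inj x y z : sub_diagram x z -> sub_diagram y z ->
  up x = up y -> low x = low y -> x = y.
Proof.
move=> /sub_diagramP xz /sub_diagramP yz /setP ux /setP lx.
have eU i : mt x (inl i) = mt y (inl i).
  have := ux i; rewrite !inE.
  have [->|->] := xz (inl i); first by rewrite eqxx => /esym/negbFE/eqP.
  by have [->|->] := yz (inl i); first by rewrite eqxx => /negbFE/eqP.
apply: mt_ext_half => // i j xi.
have [ji|ji] := eqVneq j i.
  subst j; case yi: (mt y (inr i)) => [k|k].
    by have := eU k; rewrite -yi mtK => /(canRL (mtK x)); rewrite xi.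
  have := lx i; rewrite !inE xi yi eqxx /= => /esym/negbT.
  by rewrite andbT negbK => /eqP.
have := lx i; rewrite !inE xi /= andbT (inj_eq inr_inj) ji => /esym/andP[yi _].
by case: (yz (inr i)) yi => [->|->]; rewrite ?eqxx // -xi => _;
   case: (xz (inr i)) => // e; rewrite xi in e; case: e => e; rewrite e eqxx in ji.
Qed.

End Diagrams.

(** * Completion of partial diagrams and the upper bound *)

Section BrauerCompletion.
Variable n : nat.
Local Notation PB := (partial_brauer n).
Implicit Types x y : PB.

Lemma brauerP x : reflect (forall a, mt x a != a) (is_brauer (val x)).
Proof.
apply: (iffP idP) => [bx a|nx]; first exact: mate_neq.
rewrite /is_brauer (forall_blocks _ (fun c : nat => c == 2)); apply/forallP=> a.
have -> : pblock (blocks (val x)) a = [set a; mt x a].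
  by apply/setP=> b; rewrite !inE -same_mtE.
by rewrite cards2 [a == _]eq_sym nx.
Qed.

(** The unmatched points are even in number, and any two of them may be
    matched. *)
Lemma completion x : exists2 y, is_brauer (val y) & sub_diagram x y.
Proof.
have [m] := ubnP #|[set a | mt x a == a]|; elim: m x => // m IH x.
set F := [set a | _] => ltF.
have [F0|[a Fa]] := set_0Vmem F.
  exists x; last exact: sub_diagram_refl.
  by apply/brauerP => a; apply/negP => xa; have := in_set0 a; rewrite -F0 inE xa.
have evF : ~~ odd #|F|.
  have evC : ~~ odd #|~: F|.
    apply: (even_card_involution (mtK x)) => b; rewrite !inE //.
    by rewrite (inj_eq (inv_inj (mtK x))).
  have := cardsC F; rewrite card_sum card_ord addnn => /(congr1 odd).
  by rewrite oddD odd_double (negbTE evC) addbF => ->.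
have [b] : exists b, b \in F :\ a.
  apply/set0Pn; apply: contra evF => /eqP Fa0.
  by rewrite (cardsD1 a) Fa Fa0 cards0.
rewrite !inE in Fa * => /andP[ba /eqP xb]; move/eqP: Fa => xa.
pose mu c := if c == a then b else if c == b then a else mt x c.
have muK : involutive mu.
  move=> c; rewrite /mu; have [->|ca] := eqVneq c a.
    by rewrite (negbTE ba) eqxx.
  have [->|cb] := eqVneq c b; first by rewrite eqxx.
  by rewrite -{1}xa -{2}xb !(inj_eq (inv_inj (mtK x))) (negbTE ca) (negbTE cb) mtK.
have sxy : sub_diagram x (involution_diagram muK).
  apply/sub_diagramP => c; rewrite mt_involution /mu.
  by have [->|_] := eqVneq c a; [left|have [->|_] := eqVneq c b; [left|right]].
have [|y by_ sy] := IH (involution_diagram muK).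
  rewrite -ltnS; apply: leq_trans ltF; rewrite ltnS.
  apply/proper_card/properP; split.
    apply/subsetP=> c; rewrite !inE mt_involution /mu.
    have [->|_] := eqVneq c a; first by rewrite (negbTE ba).
    by have [->|_] := eqVneq c b; first by rewrite eq_sym (negbTE ba).
  by exists a; rewrite !inE ?xa ?mt_involution /mu eqxx.
exists y => //; apply/sub_diagramP => c.
move/sub_diagramP: sxy => /(_ c); move/sub_diagramP: sy => /(_ c).
by move=> [->|->] [->|->]; by [left|right].
Qed.

(** The upper points which are not on a transversal are paired by hooks. *)
Lemma odd_rank x : is_brauer (val x) -> odd (rank x) = odd n.
Proof.
move=> /brauerP nx.
have ev : ~~ odd #|~: transversals x|.
  rewrite -(card_imset _ (@inl_inj 'I_n 'I_n)).
  apply: (even_card_involution (mtK x)) => // _ /imsetP[i xi ->].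
  rewrite !inE in xi; case e: (mt x (inl i)) xi => [j|//] _.
  by apply: imset_f; rewrite !inE -e mtK.
have := cardsC (transversals x); rewrite card_ord => /(congr1 odd) <-.
by rewrite oddD (negbTE ev) addbF.
Qed.

End BrauerCompletion.

Section UpperBound.
Variable n : nat.
Local Notation PB := (partial_brauer n).
Implicit Types (x y : brauer n) (p q : PB).

Definition incl x : PB := Sub (val x) (brauer_partial (valP x)).

Lemma inclM x y : incl (x * y) = incl x * incl y.
Proof. exact: val_inj. Qed.

Lemma incl_inj : injective incl.
Proof. by move=> x y /(congr1 val) e; apply: val_inj. Qed.

Lemma incl_brauer x : is_brauer (val (incl x)).
Proof. exact: (valP x). Qed.

Definition brauer_of p (bp : is_brauer (val p)) : brauer n := Sub (val p) bp.

Lemma incl_of p bp : incl (@brauer_of p bp) = p.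
Proof. exact: val_inj. Qed.

Lemma one_brauer : is_brauer (val (one_diagram n)).
Proof. by apply/brauerP => -[i|i]; rewrite mt1. Qed.

Lemma star_brauer x : is_brauer (val (star (incl x))).
Proof.
apply/brauerP => a; rewrite mt_star (can2_eq (@flipK n) (@flipK n)).
exact/brauerP/incl_brauer.
Qed.

(** All Brauer diagrams have ranks of the same parity, which makes the halves of
    the ranks consecutive levels. *)
Definition half_rank x := (rank (incl x))./2.

Lemma half_rank_eq x y : half_rank x = half_rank y ->
  rank (incl x) = rank (incl y).
Proof.
rewrite -[rank (incl x)]odd_double_half -[rank (incl y)]odd_double_half.
by rewrite !odd_rank ?incl_brauer // /half_rank => ->.
Qed.

Lemma rank_le x : rank (incl x) <= n.
Proof. by rewrite -[X in _ <= X]card_ord; apply: max_card. Qed.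

Lemma partial_brauer_tower : exists W, tower n./2 W /\ divides PB W.
Proof.
pose starB x := brauer_of (star_brauer x).
pose comp p := odflt (brauer_of one_brauer) [pick x | sub_diagram p (incl x)].
apply: (@ranked_cover_tower (brauer n) PB (brauer_of one_brauer) (one_diagram n)
  starB (@star n) half_rank n./2 (fun p x => sub_diagram p (incl x)) _
  (@up n) (@low n) comp [pred p | (rank p <= 1) || (p == one_diagram n)]).
- by move=> x; apply: incl_inj; rewrite inclM incl_of mul1x.
- exact: mul1x.
- exact: mulx1.
- by move=> x; apply: incl_inj; rewrite !incl_of starK.
- by move=> x y; apply: incl_inj; rewrite inclM !incl_of inclM star_mul.
- by move=> x; apply: incl_inj; rewrite !inclM incl_of mul_star.
- exact: mul_star.
- by move=> x; apply/half_leq/rank_le.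
- by move=> x y; rewrite /half_rank inclM; apply/half_leq/rank_mul_l.
- by move=> x; rewrite /half_rank incl_of rank_star.
- move=> x y /half_rank_eq; rewrite inclM => rxy.
  by apply: incl_inj; rewrite !inclM incl_of inclM mul_cancel.
- by rewrite incl_of sub_diagram_refl.
- by move=> p q x y; rewrite inclM; apply: sub_diagramM.
- by move=> p x; rewrite incl_of; apply: sub_diagram_star.
- exact: up_mul.
- move=> p q x y px qy /half_rank_eq; rewrite inclM; exact: low_mul px qy.
- by move=> p q x; apply: code_inj.
- move=> p; rewrite /comp; case: pickP => //= no.
  have [y yb py] := completion p.
  by have := no (brauer_of yb); rewrite incl_of py.
- move=> p q; rewrite !inE => /orP[rp|/eqP->]; last by rewrite mul1x.
  by move=> _; rewrite (leq_trans (rank_mul_l _ _) rp).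
- by rewrite inE eqxx orbT.
- move=> p x px r0; rewrite inE (leq_trans (rank_sub_diagram px)) //.
  by move: r0; rewrite /half_rank; case: (rank _) => [|[]].
move=> q; rewrite inE => /orP[rq|/eqP->] m p; first exact: rank_le1_acyclic.
by rewrite mulx1.
Qed.

End UpperBound.

(** * Hooks and permutations *)

Section Hooks.
Variable n : nat.
Local Notation PB := (partial_brauer n).
Implicit Types (x y : PB) (i j k l p q : 'I_n) (s t : {perm 'I_n}).

Definition perm_mate s (a : points n) : points n :=
  match a with inl i => inr (s i) | inr i => inl (s^-1 i) end.

Fact perm_diagram_exists s : {x : PB | mt x =1 perm_mate s}.
Proof.
have muK : involutive (perm_mate s) by case=> i /=; rewrite ?permK ?permKV.
by exists (involution_diagram muK); apply: mt_involution.
Qed.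

Definition perm_diagram s : PB := sval (perm_diagram_exists s).

Lemma mt_perm s a : mt (perm_diagram s) a = perm_mate s a.
Proof. exact: (svalP (perm_diagram_exists s)). Qed.

(** For i = j both copies of i are left unmatched. *)
Definition hook_mate i j (a : points n) : points n :=
  match a with
  | inl k => if (k == i) || (k == j) then inl (tperm i j k) else inr k
  | inr k => if (k == i) || (k == j) then inr (tperm i j k) else inl k
  end.

Fact hook_exists i j : {x : PB | mt x =1 hook_mate i j}.
Proof.
have tE k : ((tperm i j k == i) || (tperm i j k == j)) = (k == i) || (k == j).
  by rewrite !(can2_eq (tpermK i j) (tpermK i j)) tpermL tpermR orbC.
have muK : involutive (hook_mate i j).
  by case=> k /=; case: ifP => h /=; rewrite ?tE h ?tpermK.
by exists (involution_diagram muK); apply: mt_involution.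
Qed.

Definition hook i j : PB := sval (hook_exists i j).

Lemma mt_hook i j a : mt (hook i j) a = hook_mate i j a.
Proof. exact: (svalP (hook_exists i j)). Qed.

Lemma mt_hookL i j : mt (hook i j) (inl i) = inl j.
Proof. by rewrite mt_hook /= eqxx tpermL. Qed.

Lemma mt_hookR i j : mt (hook i j) (inl j) = inl i.
Proof. by rewrite mt_hook /= eqxx orbT tpermR. Qed.

Lemma mt_hookD i j k : k != i -> k != j -> mt (hook i j) (inl k) = inr k.
Proof. by rewrite mt_hook /= => /negbTE-> /negbTE->. Qed.

Lemma mt_hookR' i j : mt (hook i j) (inr j) = inr i.
Proof. by rewrite mt_hook /= eqxx orbT tpermR. Qed.

Lemma mt_hookD' i j k : k != i -> k != j -> mt (hook i j) (inr k) = inl k.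
Proof. by rewrite mt_hook /= => /negbTE-> /negbTE->. Qed.

Lemma hookC i j : hook i j = hook j i.
Proof.
by apply: mt_ext => -[k|k]; rewrite !mt_hook /= orbC tpermC.
Qed.

Lemma star_hook i j : star (hook i j) = hook i j.
Proof. by apply: mt_ext => -[k|k]; rewrite mt_star !mt_hook /=; case: ifP. Qed.

Lemma star_perm s : star (perm_diagram s) = perm_diagram s^-1.
Proof. by apply: mt_ext => -[k|k]; rewrite mt_star !mt_perm /= ?invgK. Qed.

Lemma hook_idem i j : hook i j * hook i j = hook i j.
Proof.
apply: mul_left_unit => k; rewrite !mt_hook /=; case: ifP => _; try by left.
  by right; exists (tperm i j k).
by right; exists (tperm i j k).
Qed.

Lemma perm_diagramM s t : perm_diagram (s * t) = perm_diagram s * perm_diagram t.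
Proof.
apply: mt_ext_half => [i|i j]; last by rewrite mt_perm.
rewrite mt_perm /= permM; symmetry.
by apply: (@mt_mul_transversal _ _ _ _ (s i)); rewrite mt_perm.
Qed.

Lemma perm_diagram1 : perm_diagram 1 = one_diagram n.
Proof. by apply: mt_ext => -[i|i]; rewrite mt_perm mt1 /= ?invg1 perm1. Qed.

(** The lower row becomes the upper row of the star, and the star of a product of
    hooks and permutations is a product of the same kind. *)
Lemma mt_ext_star x y :
    (forall i, mt x (inl i) = mt y (inl i)) ->
    (forall i, mt (star x) (inl i) = mt (star y) (inl i)) ->
  x = y.
Proof.
move=> eU eL; apply: mt_ext => -[i|i]; first exact: eU.
by have := eL i; rewrite !mt_star => /(inv_inj (@flipK n)).
Qed.

Lemma hook_perm i j s : i != j ->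
  hook i j * perm_diagram s = perm_diagram s * hook (s i) (s j).
Proof.
have half i' j' t : i' != j' -> forall k,
    mt (hook i' j' * perm_diagram t) (inl k) =
    mt (perm_diagram t * hook (t i') (t j')) (inl k).
  move=> ij k; have [->|ki] := eqVneq k i'.
    rewrite (mt_mul_upper _ (mt_hookL i' j')); symmetry.
    apply: (@mt_mul_bounce _ _ _ _ (t i') (t j'));
      rewrite 1?eq_sym ?mt_perm ?mt_hookL //.
    by rewrite /= permK.
  have [->|kj] := eqVneq k j'.
    rewrite (mt_mul_upper _ (mt_hookR i' j')); symmetry.
    apply: (@mt_mul_bounce _ _ _ _ (t j') (t i')); rewrite ?mt_perm ?mt_hookR //.
    by rewrite /= permK.
  rewrite (@mt_mul_transversal _ _ _ _ k (t k)) ?mt_hookD ?mt_perm //.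
  rewrite (@mt_mul_transversal _ _ _ _ (t k) (t k)) ?mt_perm //.
  by rewrite mt_hookD ?(inj_eq perm_inj).
move=> ij; apply: mt_ext_star; first exact: half.
move=> k; rewrite !star_mul star_hook star_perm star_hook.
by have := half (s i) (s j) s^-1; rewrite (inj_eq perm_inj) !permK => ->.
Qed.

Lemma hook_comm i j k l :
    i != j -> k != l -> i != k -> i != l -> j != k -> j != l ->
  hook i j * hook k l = hook k l * hook i j.
Proof.
have half i' j' k' l' :
    i' != j' -> k' != l' -> i' != k' -> i' != l' -> j' != k' -> j' != l' ->
    mt (hook i' j' * hook k' l') (inl i') = mt (hook k' l' * hook i' j') (inl i').
  move=> ij kl ik il jk jl; rewrite (mt_mul_upper _ (mt_hookL i' j')); symmetry.
  apply: (@mt_mul_bounce _ _ _ _ i' j');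
    [exact: mt_hookD|exact: mt_hookL|exact: mt_hookD'|by rewrite eq_sym].
have half' i' j' k' l' :
    i' != j' -> k' != l' -> i' != k' -> i' != l' -> j' != k' -> j' != l' ->
    forall m,
    mt (hook i' j' * hook k' l') (inl m) = mt (hook k' l' * hook i' j') (inl m).
  move=> ij kl ik il jk jl m.
  have [->|mi] := eqVneq m i'; first exact: half.
  have [->|mj] := eqVneq m j'.
    by rewrite !(hookC i'); apply: half; rewrite // eq_sym.
  have [->|mk] := eqVneq m k'.
    by symmetry; apply: half; rewrite // eq_sym.
  have [->|ml] := eqVneq m l'.
    by rewrite !(hookC k'); symmetry; apply: half; rewrite // eq_sym.
  by rewrite !(@mt_mul_transversal _ _ _ _ m m) ?mt_hookD.
move=> ij kl ik il jk jl; apply: mt_ext_star; first exact: half'.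
by move=> m; rewrite !star_mul !star_hook; symmetry; apply: half'.
Qed.

Lemma hook_hook i j k : i != j -> j != k -> i != k ->
  hook i j * hook j k = hook i j * perm_diagram (tperm i k).
Proof.
have half i' j' k' : i' != j' -> j' != k' -> i' != k' -> forall m,
    mt (hook i' j' * hook j' k') (inl m) =
    mt (hook i' j' * perm_diagram (tperm i' k')) (inl m).
  move=> ij jk ik m.
  have [->|mi] := eqVneq m i'; first by rewrite !(mt_mul_upper _ (mt_hookL i' j')).
  have [->|mj] := eqVneq m j'; first by rewrite !(mt_mul_upper _ (mt_hookR i' j')).
  have [->|mk] := eqVneq m k'.
    have kD : mt (hook i' j') (inl k') = inr k' by apply: mt_hookD; rewrite eq_sym.
    rewrite (mt_mul_through kD (mt_hookR _ _) (mt_hookR' _ _) (mt_hookD ij ik)).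
    by symmetry; apply: mt_mul_transversal kD _; rewrite mt_perm /= tpermR.
  rewrite (@mt_mul_transversal _ _ _ _ m m) ?mt_hookD //.
  rewrite (@mt_mul_transversal _ _ _ _ m m) ?mt_hookD ?mt_perm //=.
  by rewrite tpermD // eq_sym.
move=> ij jk ik; apply: mt_ext_star; first exact: half.
move=> m; rewrite !star_mul !star_hook star_perm tpermV.
have -> : perm_diagram (tperm i k) * hook i j = hook k j * perm_diagram (tperm i k).
  by rewrite hook_perm 1?eq_sym // tpermR tpermD // eq_sym.
by rewrite (hookC j k) (hookC i j) tpermC half 1?eq_sym.
Qed.

End Hooks.

(** * Lower bound for semigroups with permutations and hooks *)

(** The relations between permutations and hooks suffice for the lower bound,
    apart from the groups being nontrivial. This is seen on the strands, where
    strand x i j means that x joins i in the upper row to j in the lower row. *)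
Section HookRelations.
Variables (n' : nat) (S : finSemigroupType).
Let n := n'.+1.
Variables (pd : {perm 'I_n} -> S) (hook : 'I_n -> 'I_n -> S).
Variable strand : S -> 'I_n -> 'I_n -> Prop.
Implicit Types (x y : S) (i j p q : 'I_n) (s t : {perm 'I_n}) (k m : nat).

Hypotheses (pd1x : forall x, pd 1 * x = x) (pdx1 : forall x, x * pd 1 = x)
  (pdM : forall s t, pd (s * t) = pd s * pd t).
Hypotheses (hookC : forall i j, hook i j = hook j i)
  (hook_idem : forall i j, hook i j * hook i j = hook i j)
  (hook_perm : forall i j s, i != j -> hook i j * pd s = pd s * hook (s i) (s j))
  (hook_comm : forall i j (k l : 'I_n), i != j -> k != l -> i != k -> i != l ->
     j != k -> j != l -> hook i j * hook k l = hook k l * hook i j)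
  (hook_hook : forall i j (k : 'I_n), i != j -> j != k -> i != k ->
     hook i j * hook j k = hook i j * pd (tperm i k)).
Hypotheses (strand_uniq : forall x i j (k : 'I_n),
     strand x i j -> strand x i k -> j = k)
  (strandM : forall x y i j (k : 'I_n),
     strand x i j -> strand y j k -> strand (x * y) i k)
  (strand_pd : forall s i, strand (pd s) i (s i))
  (strand_hook : forall i j (k : 'I_n),
     k != i -> k != j -> strand (hook i j) k k).

(** The hook p q leaves two free places, through which the strands i and j are
    exchanged as in a sliding puzzle. *)
Lemma hook_tperm p q i j : p != q -> i != j -> i != p -> i != q -> j != p ->
    j != q ->
  hook p q * pd (tperm i j) = hook p q * hook q i * hook q j * hook p q.
Proof.
move=> pq ij ip iq jp jq.
have [qp pi qi pj qj] : [/\ q != p, p != i, q != i, p != j & q != j].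
  by split; rewrite eq_sym.
have ji : j != i by rewrite eq_sym.
rewrite (hook_hook pq qi pi) -(mulgA (hook p q)).
have -> : pd (tperm p i) * hook q j = hook q j * pd (tperm p i).
  by rewrite hook_perm // !tpermD.
rewrite mulgA (hook_hook pq qj pj) -!mulgA (mulgA (pd _)) -pdM.
set s := tperm p j * tperm p i.
have -> : pd s * hook p q = hook i q * pd s.
  rewrite hook_perm // /s !permM (tpermD pi ji) tpermR.
  by rewrite (tpermD pq jq) (tpermD pq iq).
rewrite (hookC i q) mulgA (hook_hook pq qi pi) -mulgA -pdM; congr (_ * pd _).
by rewrite /s -{1}(tpermV p i) -conjgE tpermJ tpermL tpermD.
Qed.

Definition movable k : {set 'I_n} := [set i : 'I_n | k.*2 <= i].

Definition perms_from (k : nat) : {group {perm 'I_n}} :=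
  <<[set tperm i j | i in movable k, j in movable k]>>%G.

Definition pt m : 'I_n := inord m.

(** The k-th idempotent uses up the points below 2 * k in pairs, and the k-th
    group permutes the other ones. *)
Fixpoint hooks k : S :=
  if k is k'.+1 then hooks k' * hook (pt k'.*2) (pt k'.*2.+1) else pd 1.

Lemma perms_from_fix k s i : s \in perms_from k -> i < k.*2 -> s i = i.
Proof.
move=> ss ik; suff : perms_from k \subset 'C[i | 'P].
  by move=> sub; have /astab1P := subsetP sub _ ss.
rewrite gen_subG; apply/subsetP=> _ /imset2P[a b ka kb ->].
rewrite !inE in ka kb; apply/astab1P.
by apply: tpermD; apply: contraTneq ik => <-; rewrite -leqNgt.
Qed.

Lemma val_pt m : m < n -> pt m = m :> nat.
Proof. by move=> mn; rewrite /pt inordK. Qed.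

Lemma pt_neq l m : l < m -> m < n -> pt l != pt m.
Proof.
move=> lm mn; rewrite -val_eqE /= !val_pt ?(ltn_trans lm) //.
by rewrite ltn_eqF.
Qed.

Lemma tperm_from k i j : k.*2 <= i -> k.*2 <= j -> tperm i j \in perms_from k.
Proof. by move=> ki kj; apply: mem_gen; apply/imset2P; exists i j; rewrite ?inE. Qed.

Lemma hooks_pd k s : k.*2 <= n -> s \in perms_from k ->
  hooks k * pd s = pd s * hooks k.
Proof.
elim: k => [|k IH] kn ss /=; first by rewrite pd1x pdx1.
have k2n : k.*2.+1 < n by rewrite -doubleS.
rewrite -mulgA hook_perm ?pt_neq //.
rewrite !(perms_from_fix ss) ?val_pt ?doubleS // ?(ltn_trans _ k2n) //.
rewrite mulgA IH ?mulgA //; first exact: ltnW (ltnW kn).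
move: ss; apply/subsetP/genS/imset2S; apply/subsetP=> i; rewrite !inE;
  apply: leq_trans; by rewrite leq_double.
Qed.

Lemma hooks_hook k i j : k.*2 <= n -> i != j -> k.*2 <= i -> k.*2 <= j ->
  hooks k * hook i j = hook i j * hooks k.
Proof.
move=> kn ij; elim: k kn => [|k IH] kn ki kj /=; first by rewrite pd1x pdx1.
have k2n : k.*2.+1 < n by rewrite -doubleS.
rewrite doubleS in ki kj.
have neq m (l : 'I_n) : m < l -> pt m != l.
  by move=> ml; rewrite -val_eqE /= val_pt ?ltn_eqF // (ltn_trans ml).
rewrite -mulgA hook_comm ?pt_neq ?neq // ?(ltnW ki) ?(ltnW kj) //.
by rewrite !mulgA (IH (ltnW (ltnW kn)) (ltnW (ltnW ki)) (ltnW (ltnW kj))).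
Qed.

Lemma hooks_idem k : k.*2 <= n -> hooks k * hooks k = hooks k.
Proof.
elim: k => [|k IH] kn /=; first exact: pd1x.
have k2n : k.*2.+1 < n by rewrite -doubleS.
set h := hook _ _.
have c : hooks k * h = h * hooks k.
  apply: hooks_hook; rewrite ?pt_neq ?val_pt // ?(ltnW k2n) ?(ltnW (ltnW k2n)) //.
by rewrite {2}c !mulgA -(mulgA (hooks k)) hook_idem -mulgA -c mulgA
  (IH (ltnW (ltnW kn))).
Qed.

Lemma strand_hooks k i : k.*2 <= n -> k.*2 <= i -> strand (hooks k) i i.
Proof.
elim: k => [|k IH] kn ki /=; first by have := strand_pd 1 i; rewrite perm1.
have k2n : k.*2.+1 < n by rewrite -doubleS.
rewrite doubleS in ki; apply: strandM; first by apply: IH; apply: ltnW; apply: ltnW.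
by apply: strand_hook; rewrite -val_eqE /= val_pt ?gtn_eqF // ltnW.
Qed.

Definition stage k : {set S} := [set hooks k * pd s | s in perms_from k].

Section Stage.
Variable k : nat.
Hypothesis kn : k.+1.*2 <= n.

Let f := hooks k.
Let p := pt k.*2.
Let q := pt k.*2.+1.

Let k2n : k.*2 <= n. Proof. by rewrite ltnW // ltnW // -doubleS. Qed.
Let p_k : k.*2 <= p. Proof. by rewrite val_pt // ltnW // -doubleS. Qed.
Let q_k : k.*2 <= q. Proof. by rewrite val_pt // -doubleS. Qed.
Let pq : p != q. Proof. by rewrite pt_neq // -doubleS. Qed.
Let ff : f * f = f. Proof. exact: hooks_idem. Qed.

Let fM x y : f * x = x * f -> f * x * (f * y) = f * (x * y).
Proof. by move=> fx; rewrite fx -!mulgA (mulgA f) ff !mulgA fx. Qed.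

Let f_pd s : s \in perms_from k -> f * pd s = pd s * f.
Proof. exact: hooks_pd. Qed.

Let f_hook i j : i != j -> k.*2 <= i -> k.*2 <= j -> f * hook i j = hook i j * f.
Proof. exact: hooks_hook. Qed.

Lemma stageP : is_subgroup (stage k).
Proof.
have sG : is_subgroup (gval (perms_from k) : {set ({perm 'I_n} : finGroupType)}).
  split=> [s t ss st|]; first exact: groupM.
  exists 1 => [|s ss]; first exact: group1.
  split; rewrite ?mul1g ?mulg1 //; exists s^-1; first by rewrite groupV.
  by rewrite mulgV mulVg.
have := @is_subgroup_image (perm_of 'I_n : finGroupType) S
  (fun s => f * pd s) _ _ sG.
apply=> s t ss _.
by rewrite pdM fM // f_pd.
Qed.

Lemma stage_unit : f \in stage k.
Proof. by apply/imsetP; exists 1; rewrite ?pdx1. Qed.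

Lemma stage_nontrivial : #|stage k| != 1%N.
Proof.
apply/negP=> /cards1P[h hE].
have hP s : s \in perms_from k -> f * pd s = h.
  by move=> ss; apply/set1P; rewrite -hE; apply: imset_f.
have e : f * pd (tperm p q) = f * pd 1 by rewrite !hP ?tperm_from.
have fp : strand f p p by apply: strand_hooks.
have h1 : strand (f * pd (tperm p q)) p q.
  by apply: strandM fp _; have := strand_pd (tperm p q) p; rewrite tpermL.
have h2 : strand (f * pd (tperm p q)) p p by rewrite e pdx1.
by case/eqP: pq; apply: strand_uniq h2 h1.
Qed.

Let conjugate c := exists h h',
  [/\ h \in stage k, h' \in stage k, h' * h = f & c = h * hooks k.+1 * h'].

(** Some permutation of the free points carries i and j to the points joined by
    the next hook. *)
Lemma conjugate_hook i j : i != j -> k.*2 <= i -> k.*2 <= j ->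
  conjugate (f * hook i j).
Proof.
move=> ij ki kj; pose s := tperm i p * tperm (tperm i p j) q.
have sk : s \in perms_from k.
  rewrite groupM ?tperm_from //.
  by case: tpermP.
have jp : tperm i p j != p.
  by apply: contra_neq ij => e; rewrite -(tpermK i p j) e tpermR.
have si : s i = p by rewrite /s permM tpermL tpermD // eq_sym.
have sj : s j = q by rewrite /s permM tpermL.
have sVk : s^-1 \in perms_from k by rewrite groupV.
exists (f * pd s), (f * pd s^-1); split.
- exact: imset_f.
- exact: imset_f.
- by rewrite fM ?f_pd // -pdM mulVg pdx1.
rewrite /= -/f -/p -/q fM; last exact: f_pd.
have sh : pd s * hook p q = hook i j * pd s by rewrite hook_perm // si sj.
rewrite sh fM; last by rewrite -mulgA -f_pd // !mulgA f_hook.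
by rewrite -mulgA -pdM mulgV pdx1.
Qed.

Let generated_hook i j : i != j -> k.*2 <= i -> k.*2 <= j ->
  generated conjugate (f * hook i j).
Proof. by move=> *; apply/Generated1/conjugate_hook. Qed.

Let ee : hooks k.+1 * hooks k.+1 = hooks k.+1. Proof. exact: hooks_idem. Qed.

Lemma generated_perm s : s \in perms_from k.+1 ->
  generated conjugate (hooks k.+1 * pd s).
Proof.
case/gen_prodgP=> m [c cA ->].
suff [] : \prod_i c i \in perms_from k.+1 /\
          generated conjugate (hooks k.+1 * pd (\prod_i c i)) by [].
elim/big_ind: _ => [|s1 s2 [ss1 g1] [ss2 g2]|i _].
- by rewrite pdx1; split; [exact: group1|exact: generated_hook].
- split; first exact: groupM.
  have -> : hooks k.+1 * pd (s1 * s2) = hooks k.+1 * pd s1 * (hooks k.+1 * pd s2).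
    rewrite mulgA -(mulgA _ (pd s1)) -hooks_pd // (mulgA (hooks k.+1)) ee.
    by rewrite -mulgA -pdM.
  exact: GeneratedM.
split; first exact: mem_gen.
case/imset2P: (cA i) => a b; rewrite !inE doubleS => ka kb ->.
have [->|ab] := eqVneq a b.
  by rewrite tperm1 pdx1; apply: generated_hook.
have neq (l : 'I_n) : k.*2.+1 < l -> l != p /\ l != q.
  move=> kl; rewrite -!val_eqE /= /p /q !val_pt; rewrite -?doubleS //.
    by rewrite !gtn_eqF // ltnW.
  by rewrite ltnW // -doubleS.
have [ap aq] := neq _ ka; have [bp bq] := neq _ kb.
have [ka' kb'] : k.*2 <= a /\ k.*2 <= b by split; apply: ltnW; apply: ltnW.
have [qa qb] : q != a /\ q != b by rewrite !(eq_sym q).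
rewrite /= -/f -/p -/q -mulgA hook_tperm // -!mulgA.
rewrite -(fM _ (f_hook pq p_k q_k)) -(fM _ (f_hook qa q_k ka')).
rewrite -(fM _ (f_hook qb q_k kb')).
by do 3?[apply: GeneratedM; first exact: generated_hook]; apply: generated_hook.
Qed.

Lemma generated_hooks : k.+2.*2 <= n -> generated conjugate (hooks k.+2).
Proof.
move=> kn2; have lt3 : k.+1.*2.+1 < n by rewrite -doubleS.
rewrite [hooks _]/= -/f -/p -/q -mulgA -(fM _ (f_hook pq p_k q_k)).
apply: GeneratedM; apply: generated_hook; rewrite ?pt_neq ?val_pt //.
- exact: ltnW.
- by rewrite leq_double.
- exact: ltnW.
by rewrite leqW // leq_double.
Qed.

End Stage.

Lemma stage_drop m k W : k.+1.*2 <= n -> tower m W ->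
    covers W (hooks k.+1 |: stage k) ->
  exists m' (W' : finSemigroupType), [/\ m = m'.+1, tower m' W' &
    k.+2.*2 <= n -> covers W' (hooks k.+2 |: stage k.+1)].
Proof.
move=> kn tW cov.
have k2n : k.*2 <= n by rewrite ltnW // ltnW // -doubleS.
have k2n1 : k.*2.+1 < n by rewrite -doubleS.
have ff := hooks_idem k2n; have ee := hooks_idem kn.
have fe : hooks k * hooks k.+1 = hooks k.+1 by rewrite /= mulgA ff.
have ef : hooks k.+1 * hooks k = hooks k.+1.
  by rewrite /= -mulgA -hooks_hook ?pt_neq ?val_pt ?(ltnW k2n1) // mulgA ff.
have uH h : h \in stage k -> hooks k * h = h.
  by case/imsetP=> s _ ->; rewrite mulgA ff.
have [m' [W' [-> tW' covX]]] := complexity_drop (stageP kn) (stage_nontrivial kn)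
  (stage_unit k) uH ee fe ef tW cov.
exists m', W'; split=> // kn2; apply: covX => x.
rewrite in_setU1 => /orP[/eqP->|/imsetP[s ss ->]].
  have lt3 : k.+1.*2.+1 < n by rewrite -doubleS.
  split; last exact: generated_hooks.
    by rewrite [hooks k.+2]/= -/(hooks k.+1) mulgA ee.
  rewrite -[hooks k.+2]/(hooks k.+1 * hook (pt k.+1.*2) (pt k.+1.*2.+1)).
  by rewrite -mulgA -hooks_hook ?pt_neq ?val_pt ?(ltnW lt3) // mulgA ee.
split; last exact: generated_perm.
  by rewrite mulgA ee.
by rewrite -mulgA -hooks_pd // mulgA ee.
Qed.

Lemma stage_depth m k W : k.+1.*2 <= n -> tower m W ->
  covers W (hooks k.+1 |: stage k) -> n./2 <= k + m.
Proof.
elim: m k W => [|m IH] k W kn tW /(stage_drop kn tW)[m' [W' [// [<-] tW' cov]]].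
have [kn2|] := leqP k.+2.*2 n; first by rewrite addnS -addSn; apply: IH (cov kn2).
rewrite doubleS ltnS -leq_half_double => le.
by rewrite (leq_trans le) // addnS ltnS leq_addr.
Qed.

Theorem hooks_depth m W (X : {set S}) : tower m W -> covers W X ->
  (forall s, pd s \in X) -> (forall i j, i != j -> hook i j \in X) -> n./2 <= m.
Proof.
move=> tW [U [f [clU fM /subsetP XU]]] Xpd Xhook.
have [n2|] := leqP 2 n; last first.
  by rewrite ltnS => n1; rewrite (leq_trans (half_leq n1)).
apply: (@stage_depth m 0 W) => //; exists U, f; split=> //; apply/subsetP=> x.
rewrite in_setU1 => /orP[/eqP->|/imsetP[s _ ->]]; rewrite /= pd1x; apply: XU => //.
by apply: Xhook; rewrite pt_neq.
Qed.

End HookRelations.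

(** * Complexity of the Brauer semigroups *)

Lemma brauer_divides n W : divides (partial_brauer n) W -> divides (brauer n) W.
Proof.
move=> [U [f [clU fM fU]]].
pose g w : brauer n := insubd (brauer_of (one_brauer n)) (val (f w)).
pose V := [set w in U | is_brauer (val (f w))].
have VP w : w \in V -> w \in U /\ is_brauer (val (f w)).
  by rewrite inE => /andP[].
have VM v w : v \in V -> w \in V -> v * w \in V.
  move=> /VP[Uv bv] /VP[Uw bw]; rewrite inE clU //= fM //.
  exact: brauer_mul.
have gE w : w \in V -> val (g w) = val (f w).
  by move=> /VP[_ bw]; apply: insubdK.
exists V, g; split=> [v w|v w Vv Vw|]; first exact: VM.
  have [[Uv _] [Uw _]] := (VP _ Vv, VP _ Vw).
  apply: val_inj; rewrite gE ?VM // fM // -[RHS]/(val (g v) * val (g w)).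
  by rewrite !gE.
apply/setP=> x; rewrite inE; apply/imsetP.
have /imsetP[w Uw xw] : incl x \in f @: U by rewrite fU inE.
have bw : is_brauer (val (f w)) by rewrite -xw; apply: incl_brauer.
have Vw : w \in V by rewrite inE Uw.
by exists w => //; apply: val_inj; rewrite gE // -xw.
Qed.

Lemma perm_diagram_brauer n (s : {perm 'I_n}) : is_brauer (val (perm_diagram s)).
Proof. by apply/brauerP => -[i|i]; rewrite mt_perm. Qed.

Lemma hook_brauer n (i j : 'I_n) : i != j -> is_brauer (val (hook i j)).
Proof.
move=> ij; apply/brauerP => -[k|k]; rewrite mt_hook /=; case: ifP => //;
  case/orP=> /eqP->;
  rewrite ?tpermL ?tpermR ?(inj_eq inl_inj) ?(inj_eq inr_inj) //;
  by rewrite eq_sym.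
Qed.

Lemma brauer_depth n m W :
  0 < n -> tower m W -> divides (brauer n) W -> n./2 <= m.
Proof.
case: n => // n _ tW [U [f [clU fM fU]]].
pose X := [set x : partial_brauer n.+1 | is_brauer (val x)].
have covX : covers W X.
  exists U, (fun w => incl (f w)); split=> //.
    by move=> v w Uv Uw; rewrite -inclM fM.
  apply/subsetP=> x; rewrite inE => bx; rewrite -(incl_of bx) imset_comp fU.
  by rewrite imset_f ?inE.
apply: (@hooks_depth n (partial_brauer n.+1) (@perm_diagram n.+1) (@hook n.+1)
  (fun x i j => mt x (inl i) = inr j) _ _ _ _ _ _ _ _ _ _ _ _ m W X tW covX).
- by move=> x; rewrite perm_diagram1 mul1x.
- by move=> x; rewrite perm_diagram1 mulx1.
- exact: perm_diagramM.
- exact: hookC.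
- exact: hook_idem.
- exact: hook_perm.
- exact: hook_comm.
- exact: hook_hook.
- by move=> x i j k -> [].
- exact: mt_mul_transversal.
- by move=> s i; rewrite mt_perm.
- by move=> i j k ki kj; apply: mt_hookD.
- by move=> s; rewrite inE perm_diagram_brauer.
by move=> i j ij; rewrite inE hook_brauer.
Qed.

Theorem corollary3p3 (n : nat) (n_gt0 : (0 < n)%N) :
  has_complexity (partial_brauer n) n./2 /\ has_complexity (brauer n) n./2.
Proof.
have [W [tW dW]] := partial_brauer_tower n.
have lower k V : tower k V -> divides (brauer n) V -> n./2 <= k.
  exact: brauer_depth.
split; split; try (apply/decomposableP; exists W; split=> //).
- by move=> k /decomposableP[V [tV dV]]; apply: lower tV (brauer_divides dV).
- exact: brauer_divides.
by move=> k /decomposableP[V [tV dV]]; apply: lower tV dV.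
Qed.
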